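(* Let $F$ be a field and $n\ge 1$. Write $\big(\mathrm{St}_n(F)\otimes\mathrm{St}_n(F)\big)_{\mathrm{SL}_n(F)}$ for the coinvariants of the diagonal $\mathrm{SL}_n(F)$-action on the double Steinberg module. (i) $\big(\mathrm{St}_n(F)\otimes\mathrm{St}_n(F)\big)_{\mathrm{SL}_n(F)}$ is a quotient of $\mathbb Z[F^\times/(F^\times)^n]$ as a $\mathbb{Z}[F^\times]$-module. (ii) If $F$ contains an $n$th root of $-1$, then $\big(\mathrm{St}_n(F)\otimes\mathrm{St}_n(F)\big)_{\mathrm{SL}_n(F)}$ is, as an abelian group, of the form $\mathbb Z\oplus T$ where $T$ is $n$-torsion, i.e. $nT=0$.
   Context: For $n\ge 1$, the Steinberg module $\mathrm{St}_n(F)$ is the top reduced homology of the Tits building of $F^n$; it is given by the following presentation: it is the quotient of the free abelian group on symbols $[A]$, $A\in \mathrm{GL}_n(F)$, where we write $[A]=[v_1,\dots,v_n]$ if the $i$th column of $A$ is $v_i$, by the relations (a) $[v_1,\dots,v_n]=[v_1,\dots,v_i+\lambda v_j,\dots,v_j,\dots,v_n]+[v_1,\dots,v_i,\dots,v_i+\lambda v_j,\dots,v_n]$ for $\lambda\in F^\times$, $1\le i<j\le n$ (in the first summand the $i$th column is replaced by $v_i+\lambda v_j$, in the second summand the $j$th column is); (b) $[v_1,\dots,v_n]=[v_1,\dots,\lambda v_i,\dots,v_n]$ for $\lambda\in F^\times$, $1\le i\le n$; (c) $[v_1,\dots,v_n]=(-1)^\sigma[v_{\sigma(1)},\dots,v_{\sigma(n)}]$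 for $\sigma\in\mathfrak S_n$, where $(-1)^\sigma$ is the sign of $\sigma$. The group $\mathrm{GL}_n(F)$ acts on $\mathrm{St}_n(F)$ by $M\cdot[A]=[MA]$ and diagonally on $\mathrm{St}_n(F)\otimes\mathrm{St}_n(F)$ (tensor product over $\mathbb Z$). The $\mathrm{SL}_n(F)$-coinvariants carry a residual action of $\mathrm{GL}_n(F)/\mathrm{SL}_n(F)\cong F^\times$ (via the determinant), making them a $\mathbb Z[F^\times]$-module; the group ring $\mathbb Z[F^\times/(F^\times)^n]$ is a $\mathbb Z[F^\times]$-module via the quotient map $F^\times\to F^\times/(F^\times)^n$. *)

(* Defs.v *)
From HB Require Import structures.
From mathcomp Require Import all_boot all_order all_fingroup all_algebra.
From mathcomp Require Import generic_quotient ring_quotient.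
From mathcomp Require Import boolp.
From mathcomp Require Import freeg.

Set Implicit Arguments.
Unset Strict Implicit.
Unset Printing Implicit Defensive.

Import GRing.Theory.
Local Open Scope ring_scope.
Local Open Scope quotient_scope.

Definition fgen (K : choiceType) (k : K) : {freeg K} := << k >>.

Definition flift (K : choiceType) (V : zmodType) (f : K -> V) (D : {freeg K}) : V :=
  \sum_(k <- dom D) f k *~ coeff k D.

Lemma freeg_ind (K : choiceType) (P : {freeg K} -> Prop) :
  P 0 -> (forall x y, P x -> P y -> P (x - y)) -> (forall k, P (fgen k)) ->
  forall D, P D.
Proof.
move=> P0 PB Pg D; rewrite -[D]freeg_sumE.
have PN x : P x -> P (- x) by move=> Px; rewrite -sub0r; apply: PB.
have PD x y : P x -> P y -> P (x + y).
  by move=> Px /PN Py; rewrite -[y]opprK; apply: PB.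
elim/big_ind: _ => //= k _; move: (coeff k D) => z.
have -> : << z *g k >> = fgen k *~ z.
  by rewrite /fgen freegU_mulz intz.
have Pn n : P (fgen k *+ n).
  by elim: n => [|n IH]; rewrite ?mulr0n ?mulrS //; apply: PD.
by case: z => n; rewrite ?NegzE ?mulrNz -!pmulrn //; apply: PN.
Qed.

Section FreeLift.
Variables (K : choiceType) (V : zmodType) (f : K -> V).

Lemma fliftE (D : {freeg K}) : flift f D = fglift (f : K -> zmodule V) D.
Proof.
have /= aL := lift_is_additive (f : K -> zmodule V).
pose L : {additive {freeg K} -> zmodule V} :=
  HB.pack (fglift (f : K -> zmodule V))
    (GRing.isZmodMorphism.Build _ _ (fglift (f : K -> zmodule V)) aL).
rewrite -[in RHS](freeg_sumE D) -[fglift _]/(L : _ -> _) raddf_sum /=.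
by apply: eq_bigr => k _; rewrite liftU.
Qed.

Lemma flift_is_zmod_morphism : zmod_morphism (flift f).
Proof. by move=> x y; rewrite !fliftE (lift_is_additive (f : K -> zmodule V)). Qed.

HB.instance Definition _ :=
  GRing.isZmodMorphism.Build {freeg K} V (flift f) flift_is_zmod_morphism.

Lemma flift_gen k : flift f (fgen k) = f k.
Proof. by rewrite fliftE liftU scale1r. Qed.

End FreeLift.

Lemma freeg_ext (K : choiceType) (V : zmodType)
    (f g : {additive {freeg K} -> V}) :
  (forall k, f (fgen k) = g (fgen k)) -> f =1 g.
Proof.
move=> fg; apply: freeg_ind => [|x y fx fy|//]; first by rewrite !raddf0.
by rewrite !raddfB fx fy.
Qed.

Section GeneratedSubgroup.
Variables (V : zmodType) (S : V -> Prop).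

(* The intersection of all subgroups containing S. *)
Definition in_gen (x : V) : Prop :=
  forall H : V -> Prop, H 0 -> (forall u v, H u -> H v -> H (u - v)) ->
    (forall s, S s -> H s) -> H x.

Definition gen_subgroup : {pred V} := fun x => `[< in_gen x >].

Lemma gen_subgroup_zmod_closed : zmod_closed gen_subgroup.
Proof.
split; first by apply/asboolP => H.
move=> x y /asboolP Sx /asboolP Sy; apply/asboolP => H H0 HB HS.
by apply: (HB); [exact: Sx | exact: Sy].
Qed.

HB.instance Definition _ :=
  GRing.isZmodClosed.Build V gen_subgroup gen_subgroup_zmod_closed.

Definition zquot : Type := Quotient.quot gen_subgroup.
HB.instance Definition _ := GRing.Zmodule.on zquot.
HB.instance Definition _ := Quotient.on zquot.

Definition cls (x : V) : zquot := \pi_(Quotient.quot gen_subgroup) x.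

Lemma cls_is_zmod_morphism : zmod_morphism cls.
Proof.
by move=> x y; exact: (@raddfB V (Quotient.quot gen_subgroup) \pi x y).
Qed.
HB.instance Definition _ :=
  GRing.isZmodMorphism.Build V zquot cls cls_is_zmod_morphism.

Lemma cls_eqP x y : cls x = cls y <-> in_gen (x - y).
Proof.
split=> [/eqP|] h.
  by apply/asboolP; move: h; rewrite /cls -Quotient.idealrBE.
by apply/eqP; rewrite /cls -Quotient.idealrBE; apply/asboolP.
Qed.

Lemma cls_gen s : S s -> cls s = 0.
Proof.
move=> Ss; rewrite -(raddf0 cls); apply/cls_eqP => H _ _ HS.
by rewrite subr0; apply: HS.
Qed.

Lemma cls_rel x y : S (x - y) -> cls x = cls y.
Proof. by move=> Sxy; apply/eqP; rewrite -subr_eq0 -(raddfB cls) /= cls_gen. Qed.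

Lemma cls_surj q : exists x, cls x = q.
Proof. by exists (repr q); rewrite /cls reprK. Qed.

(* Meaningful when f is additive and kills S: see qlift_cls. *)
Definition qlift (W : zmodType) (f : V -> W) (q : zquot) : W := f (repr q).

Lemma qlift_cls (W : zmodType) (f : {additive V -> W}) :
  (forall s, S s -> f s = 0) -> forall x, qlift f (cls x) = f x.
Proof.
move=> fS x; apply/eqP; rewrite -subr_eq0 -raddfB; apply/eqP.
have /cls_eqP h : cls (repr (cls x)) = cls x by rewrite /cls reprK.
apply: (h (fun u => f u = 0)); [exact: raddf0 | | exact: fS].
by move=> u v fu fv; rewrite raddfB fu fv subr0.
Qed.

End GeneratedSubgroup.

Arguments cls {V} S x.
Arguments qlift {V} S {W} f q.

Lemma zquot_ind (V : zmodType) (S : V -> Prop) (P : zquot S -> Prop) :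
  (forall x, P (cls S x)) -> forall q, P q.
Proof. by move=> Px q; case: (cls_surj q) => x <-. Qed.

Section Tensor.
Variables V W : zmodType.

Inductive tensor_rel : {freeg (V * W)} -> Prop :=
| Tensor_addl v v' w :
    tensor_rel (fgen (v + v', w) - (fgen (v, w) + fgen (v', w)))
| Tensor_addr v w w' :
    tensor_rel (fgen (v, w + w') - (fgen (v, w) + fgen (v, w'))).

Definition tensor : zmodType := zquot tensor_rel.

Definition tens (v : V) (w : W) : tensor := cls tensor_rel (fgen (v, w)).

Lemma tensDl v v' w : tens (v + v') w = tens v w + tens v' w.
Proof.
by rewrite -[RHS](raddfD (cls tensor_rel)); apply: cls_rel; constructor.
Qed.

Lemma tensDr v w w' : tens v (w + w') = tens v w + tens v w'.
Proof.
by rewrite -[RHS](raddfD (cls tensor_rel)); apply: cls_rel; constructor.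
Qed.

Lemma tensor_ext (U : zmodType) (f g : {additive tensor -> U}) :
  (forall v w, f (tens v w) = g (tens v w)) -> f =1 g.
Proof.
move=> fg; elim/zquot_ind; apply: freeg_ind => [|x y fx fy|[v w]].
- by rewrite !raddf0.
- by rewrite !raddfB fx fy.
- exact: fg.
Qed.

End Tensor.

Section TensorMap.
Variables (V W V' W' : zmodType) (f : {additive V -> V'}) (g : {additive W -> W'}).

Let pre (p : V * W) : tensor V' W' := tens (f p.1) (g p.2).

Definition tensor_map : tensor V W -> tensor V' W' :=
  qlift (@tensor_rel V W) (flift pre).

Let tensor_map_rel s : tensor_rel s -> flift pre s = 0.
Proof.
by case=> *; rewrite raddfB raddfD /= !flift_gen /pre /= raddfD
  ?tensDl ?tensDr subrr.
Qed.

Lemma tensor_map_is_zmod_morphism : zmod_morphism tensor_map.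
Proof.
elim/zquot_ind=> x; elim/zquot_ind=> y.
rewrite -raddfB /tensor_map !(qlift_cls tensor_map_rel); exact: raddfB.
Qed.
HB.instance Definition _ := GRing.isZmodMorphism.Build _ _ tensor_map
  tensor_map_is_zmod_morphism.

Lemma tensor_mapE v w : tensor_map (tens v w) = tens (f v) (g w).
Proof. by rewrite /tensor_map (qlift_cls tensor_map_rel) /= flift_gen. Qed.

End TensorMap.

Definition groupRing (G : groupType) : Type := {freeg G}.
HB.instance Definition _ (G : groupType) := GRing.Zmodule.on (groupRing G).

Lemma groupRing_ind (G : groupType) (P : groupRing G -> Prop) :
  P 0 -> (forall x y, P x -> P y -> P (x - y)) -> (forall g, P (fgen g)) ->
  forall x, P x.
Proof. exact: freeg_ind. Qed.

Lemma zmod_mor0 (U V : zmodType) (f : U -> V) : zmod_morphism f -> f 0 = 0.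
Proof. by move=> fB; rewrite -[0 in LHS](subrr 0) fB subrr. Qed.

Lemma zmod_morD (U V : zmodType) (f : U -> V) :
  zmod_morphism f -> {morph f : x y / x + y}.
Proof.
move=> fB x y; have fN z : f (- z) = - f z.
  by rewrite -[- z]sub0r fB zmod_mor0 // sub0r.
by rewrite -[in LHS](opprK y) fB fN opprK.
Qed.

Section GroupRing.
Variable G : groupType.
Implicit Types (x y z : groupRing G) (g h : G).

Definition gr_one : groupRing G := fgen 1%g.

Definition gr_mul x y : groupRing G :=
  flift (fun g => flift (fun h => fgen (g * h)%g : groupRing G) y) x.

Let gr_mulBl y : zmod_morphism (gr_mul^~ y).
Proof. by move=> x x'; exact: flift_is_zmod_morphism. Qed.

Let gr_mulBr x : zmod_morphism (gr_mul x).
Proof.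
move=> y y'; rewrite /gr_mul /flift -sumrB; apply: eq_bigr => g _.
by rewrite -mulrzBl; congr (_ *~ _); exact: flift_is_zmod_morphism.
Qed.

Let gr_mul0l y : gr_mul 0 y = 0.
Proof. exact: zmod_mor0 (gr_mulBl y). Qed.

Let gr_mul0r x : gr_mul x 0 = 0.
Proof. exact: zmod_mor0 (gr_mulBr x). Qed.

Lemma gr_mul_gen g h : gr_mul (fgen g) (fgen h) = fgen (g * h)%g.
Proof. by rewrite /gr_mul !flift_gen. Qed.

Lemma gr_mulA : associative gr_mul.
Proof.
move=> x y z; elim/groupRing_ind: x => [|x x' ex ex'|g].
- by rewrite !gr_mul0l.
- by rewrite !gr_mulBl ex ex'.
elim/groupRing_ind: y => [|y y' ey ey'|h].
- by rewrite gr_mul0r !gr_mul0l gr_mul0r.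
- by rewrite gr_mulBl !gr_mulBr ey ey' gr_mulBl.
elim/groupRing_ind: z => [|z z' ez ez'|k].
- by rewrite !gr_mul0r.
- by rewrite !gr_mulBr ez ez'.
by rewrite !gr_mul_gen mulgA.
Qed.

Lemma gr_mul1 : left_id gr_one gr_mul.
Proof.
elim/groupRing_ind=> [|x y ex ey|g]; first exact: gr_mul0r.
  by rewrite gr_mulBr ex ey.
by rewrite gr_mul_gen mul1g.
Qed.

Lemma gr_mulr1 : right_id gr_one gr_mul.
Proof.
elim/groupRing_ind=> [|x y ex ey|g]; first exact: gr_mul0l.
  by rewrite gr_mulBl ex ey.
by rewrite gr_mul_gen mulg1.
Qed.

Lemma gr_mulDl : left_distributive gr_mul +%R.
Proof. by move=> x y z; exact: zmod_morD (gr_mulBl z) x y. Qed.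

Lemma gr_mulDr : right_distributive gr_mul +%R.
Proof. by move=> x y z; exact: zmod_morD (gr_mulBr x) y z. Qed.

Lemma gr_one_neq0 : gr_one != 0.
Proof. by rewrite /gr_one /fgen freegU_eq0. Qed.

HB.instance Definition _ := GRing.Zmodule_isNzRing.Build (groupRing G)
  gr_mulA gr_mul1 gr_mulr1 gr_mulDl gr_mulDr gr_one_neq0.

Lemma groupRing_mul_gen g h : (fgen g : groupRing G) * fgen h = fgen (g * h)%g.
Proof. exact: gr_mul_gen. Qed.

End GroupRing.

(* act_scale (\sum_g n_g g) v = \sum_g n_g (a g v): an action of G on V by group
   endomorphisms is the same thing as a Z[G]-module structure on V. *)
Section ActionModule.
Variables (G : groupType) (V : zmodType) (a : G -> V -> V).
Hypothesis aB : forall g, zmod_morphism (a g).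
Hypothesis a1 : a 1%g =1 id.
Hypothesis aM : forall g h, a (g * h)%g =1 a g \o a h.

Definition act_scale (r : groupRing G) (v : V) : V := flift (a^~ v) r.

Lemma act_scale_gen g v : act_scale (fgen g) v = a g v.
Proof. exact: flift_gen. Qed.

Let act_scaleBl v : zmod_morphism (act_scale^~ v).
Proof. by move=> r s; exact: flift_is_zmod_morphism. Qed.

Let act_scaleBr r : zmod_morphism (act_scale r).
Proof.
by move=> v w; rewrite /act_scale /flift -sumrB; apply: eq_bigr => g _;
  rewrite -mulrzBl aB.
Qed.

Let act_scale0l v : act_scale 0 v = 0.
Proof. exact: zmod_mor0 (act_scaleBl v). Qed.

Let act_scale0r r : act_scale r 0 = 0.
Proof. exact: zmod_mor0 (act_scaleBr r). Qed.

Lemma act_scaleA r s v : act_scale r (act_scale s v) = act_scale (r * s) v.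
Proof.
elim/groupRing_ind: r => [|r r' er er'|g].
- by rewrite mul0r !act_scale0l.
- by rewrite mulrBl !act_scaleBl er er'.
elim/groupRing_ind: s => [|s s' es es'|h].
- by rewrite mulr0 !act_scale0l act_scale0r.
- by rewrite mulrBr !act_scaleBl act_scaleBr es es'.
by rewrite groupRing_mul_gen !act_scale_gen aM.
Qed.

Lemma act_scale1 : left_id 1 act_scale.
Proof. by move=> v; rewrite [LHS]act_scale_gen a1. Qed.

Lemma act_scaleDr : right_distributive act_scale +%R.
Proof. by move=> r v w; exact: zmod_morD (act_scaleBr r) v w. Qed.

Lemma act_scaleDl v : {morph act_scale^~ v : r s / r + s}.
Proof. by move=> r s; exact: zmod_morD (act_scaleBl v) r s. Qed.

End ActionModule.

Definition GL (F : fieldType) (n : nat) : Type := {A : 'M[F]_n | A \in unitmx}.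
HB.instance Definition _ F n := SubChoice.on (GL F n).

Definition mkGL (F : fieldType) (n : nat) (A : 'M[F]_n) (uA : A \in unitmx) :
  GL F n := exist (fun B : 'M[F]_n => B \in unitmx) A uA.

Section GLGroup.
Variables (F : fieldType) (n : nat).
Implicit Types A B : GL F n.

Lemma GLmul_subproof A B : sval A *m sval B \in unitmx.
Proof. by rewrite unitmx_mul (svalP A) (svalP B). Qed.
Lemma GLinv_subproof A : invmx (sval A) \in unitmx.
Proof. by rewrite unitmx_inv (svalP A). Qed.

Definition GLmul A B : GL F n := mkGL (GLmul_subproof A B).
Definition GLone : GL F n := mkGL (unitmx1 F n).
Definition GLinv A : GL F n := mkGL (GLinv_subproof A).

Lemma GLmulA : associative GLmul.
Proof. by move=> A B C; apply: val_inj; apply: mulmxA. Qed.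
Lemma GLmul1 : left_id GLone GLmul.
Proof. by move=> A; apply: val_inj; apply: mul1mx. Qed.
Lemma GLmulr1 : right_id GLone GLmul.
Proof. by move=> A; apply: val_inj; apply: mulmx1. Qed.
Lemma GLmulV : left_inverse GLone GLinv GLmul.
Proof. by move=> A; apply: val_inj; apply: (mulVmx (svalP A)). Qed.
Lemma GLmulrV : right_inverse GLone GLinv GLmul.
Proof. by move=> A; apply: val_inj; apply: (mulmxV (svalP A)). Qed.

HB.instance Definition _ :=
  isGroup.Build (GL F n) GLmulA GLmul1 GLmulr1 GLmulV GLmulrV.

End GLGroup.

Definition Fx (F : fieldType) : Type := {x : F | x != 0}.
HB.instance Definition _ F := SubChoice.on (Fx F).

Definition mkFx (F : fieldType) (x : F) (x0 : x != 0) : Fx F :=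
  exist (fun y : F => y != 0) x x0.

Section FxGroup.
Variable F : fieldType.
Implicit Types x y : Fx F.

Lemma Fxmul_subproof x y : sval x * sval y != 0.
Proof. by rewrite mulf_neq0 ?(svalP x) ?(svalP y). Qed.
Lemma Fxinv_subproof x : (sval x)^-1 != 0.
Proof. by rewrite invr_neq0 ?(svalP x). Qed.

Definition Fxmul x y : Fx F := mkFx (Fxmul_subproof x y).
Definition Fxone : Fx F := mkFx (oner_neq0 F).
Definition Fxinv x : Fx F := mkFx (Fxinv_subproof x).

Lemma FxmulA : associative Fxmul.
Proof. by move=> x y z; apply: val_inj; apply: mulrA. Qed.
Lemma Fxmul1 : left_id Fxone Fxmul.
Proof. by move=> x; apply: val_inj; apply: mul1r. Qed.
Lemma Fxmulr1 : right_id Fxone Fxmul.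
Proof. by move=> x; apply: val_inj; apply: mulr1. Qed.
Lemma FxmulV : left_inverse Fxone Fxinv Fxmul.
Proof. by move=> x; apply: val_inj; apply: (mulVf (svalP x)). Qed.
Lemma FxmulrV : right_inverse Fxone Fxinv Fxmul.
Proof. by move=> x; apply: val_inj; apply: (mulfV (svalP x)). Qed.

HB.instance Definition _ :=
  isGroup.Build (Fx F) FxmulA Fxmul1 Fxmulr1 FxmulV FxmulrV.

Lemma Fx_mulC x y : (x * y = y * x)%g.
Proof. by apply: val_inj; apply: mulrC. Qed.

End FxGroup.

Section PowerClasses.
Variables (F : fieldType) (n : nat).
Implicit Types x y z : Fx F.

Definition pow_equiv (x y : Fx F) : bool := `[< exists z : Fx F, x = (y * z ^+ n)%g >].

Lemma pow_equiv_is_equiv : equiv_class_of pow_equiv.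
Proof.
have comm (a b : Fx F) : commute a b by exact: Fx_mulC.
split=> [x|x y|y x z].
- by apply/asboolP; exists 1%g; rewrite expg1n mulg1.
- apply/asboolP/asboolP => -[w ->]; exists w^-1%g;
    by rewrite expVgn mulgK.
- move=> /asboolP[u ->] /asboolP[w ->]; apply/asboolP; exists (w * u)%g.
  by rewrite expgMn // mulgA.
Qed.

Canonical pow_equiv_equiv := EquivRelPack pow_equiv_is_equiv.
Canonical pow_equiv_encModRel := defaultEncModRel pow_equiv.

Definition FxModPow : Type := {eq_quot pow_equiv}.
HB.instance Definition _ : EqQuotient (Fx F) pow_equiv FxModPow :=
  EqQuotient.on FxModPow.
HB.instance Definition _ := Choice.on FxModPow.

Definition pcls (x : Fx F) : FxModPow := \pi_FxModPow x.

Lemma pcls_eqP x y : pcls x = pcls y <-> exists z : Fx F, x = (y * z ^+ n)%g.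
Proof.
split=> [/eqP|] h; first by move: h; rewrite /pcls eqmodE => /asboolP.
by apply/eqP; rewrite /pcls eqmodE; apply/asboolP.
Qed.

Definition pmul (p q : FxModPow) : FxModPow := pcls (repr p * repr q)%g.
Definition pinv (p : FxModPow) : FxModPow := pcls (repr p)^-1%g.

Lemma pcls_ind (P : FxModPow -> Prop) : (forall x, P (pcls x)) -> forall p, P p.
Proof. by move=> Px p; rewrite -[p]reprK; apply: Px. Qed.

Lemma pmulE x y : pmul (pcls x) (pcls y) = pcls (x * y)%g.
Proof.
have comm (a b : Fx F) : commute a b by exact: Fx_mulC.
have rp z : pcls (repr (pcls z)) = pcls z by rewrite /pcls reprK.
have [u eu] := (pcls_eqP _ _).1 (rp x).
have [w ew] := (pcls_eqP _ _).1 (rp y).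
apply/pcls_eqP; exists (u * w)%g; rewrite eu ew expgMn //.
by rewrite -!mulgA; congr (_ * _)%g; rewrite !mulgA (comm _ y).
Qed.

Lemma pinvE x : pinv (pcls x) = pcls x^-1%g.
Proof.
have rp z : pcls (repr (pcls z)) = pcls z by rewrite /pcls reprK.
have [u eu] := (pcls_eqP _ _).1 (rp x).
by apply/pcls_eqP; exists u^-1%g; rewrite eu invgM Fx_mulC expVgn.
Qed.

Lemma pmulA : associative pmul.
Proof.
elim/pcls_ind=> x; elim/pcls_ind=> y; elim/pcls_ind=> z.
by rewrite !pmulE mulgA.
Qed.
Lemma pmul1 : left_id (pcls 1%g) pmul.
Proof. by elim/pcls_ind=> x; rewrite pmulE mul1g. Qed.
Lemma pmulr1 : right_id (pcls 1%g) pmul.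
Proof. by elim/pcls_ind=> x; rewrite pmulE mulg1. Qed.
Lemma pmulV : left_inverse (pcls 1%g) pinv pmul.
Proof. by elim/pcls_ind=> x; rewrite pinvE pmulE mulVg. Qed.
Lemma pmulrV : right_inverse (pcls 1%g) pinv pmul.
Proof. by elim/pcls_ind=> x; rewrite pinvE pmulE mulgV. Qed.

HB.instance Definition _ := isGroup.Build FxModPow pmulA pmul1 pmulr1 pmulV pmulrV.

Lemma pclsM x y : pcls (x * y)%g = (pcls x * pcls y)%g.
Proof. by rewrite [RHS]pmulE. Qed.

(* Z[F^*/(F^* )^n], kept apart from its group ring structure in order to carry
   the Z[F^*]-module structure given by restriction along pcls. *)
Definition ZFxModPow : Type := groupRing FxModPow.
HB.instance Definition _ := GRing.Zmodule.on ZFxModPow.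

Definition pow_act (u : Fx F) (x : ZFxModPow) : ZFxModPow :=
  (fgen (pcls u) : groupRing FxModPow) * (x : groupRing FxModPow).

Lemma pow_actB u : zmod_morphism (pow_act u).
Proof. by move=> x y; exact: mulrBr. Qed.
Lemma pow_act1 : pow_act 1%g =1 id.
Proof. by move=> x; exact: mul1r. Qed.
Lemma pow_actM u v : pow_act (u * v)%g =1 pow_act u \o pow_act v.
Proof. by move=> x; rewrite /pow_act /= mulrA groupRing_mul_gen pclsM. Qed.

HB.instance Definition _ :=
  GRing.Zmodule_isLmodule.Build (groupRing (Fx F)) ZFxModPow
    (act_scaleA pow_actB pow_actM) (act_scale1 pow_act1)
    (act_scaleDr pow_actB) (@act_scaleDl _ _ pow_act).

End PowerClasses.

Definition setcol (F : fieldType) (n : nat) (A : 'M[F]_n) (k : 'I_n)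
    (v : 'cV[F]_n) : 'M[F]_n :=
  \matrix_(r, c) if c == k then v r 0 else A r c.

Lemma det_setcol (F : fieldType) (n : nat) (A : 'M[F]_n) (i j : 'I_n) (a b : F) :
  i != j -> \det (setcol A i (a *: col i A + b *: col j A)) = a * \det A.
Proof.
move=> ij; set M := setcol _ _ _; rewrite -(det_tr A) -(det_tr M) {}/M.
rewrite (@determinant_multilinear _ _ (setcol A i _)^T A^T (setcol A i (col j A))^T i a b).
- rewrite (@determinant_alternate _ _ (setcol A i (col j A))^T i j) //.
    by rewrite mulr0 addr0.
  by move=> r; rewrite !mxE eqxx eq_sym (negPf ij).
- by apply/rowP => r; rewrite !mxE eqxx.
- by apply/matrixP => k r; rewrite !mxE eq_sym ?(negPf (neq_lift _ _)).
- by apply/matrixP => k r; rewrite !mxE eq_sym ?(negPf (neq_lift _ _)).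
Qed.

(* Presentation of the Steinberg module (the top reduced homology of the Tits
   building of F^n) by symbols [A] = [v_1, ..., v_n], v_i the columns of A;
   col_perm s A has columns v_(s 1), ..., v_(s n).
   The matrices B and C below are automatically invertible, by det_setcol and
   unitmxE, so quantifying over B, C : GL F n loses no relation. *)
Inductive St_rel (F : fieldType) (n : nat) : {freeg (GL F n)} -> Prop :=
| St_sum (A B C : GL F n) (i j : 'I_n) (l : F) of
    (i < j)%N & l != 0 &
    sval B = setcol (sval A) i (col i (sval A) + l *: col j (sval A)) &
    sval C = setcol (sval A) j (col i (sval A) + l *: col j (sval A)) :
    St_rel (fgen A - (fgen B + fgen C))
| St_scale (A B : GL F n) (i : 'I_n) (l : F) of
    l != 0 & sval B = setcol (sval A) i (l *: col i (sval A)) :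
    St_rel (fgen A - fgen B)
| St_perm (A B : GL F n) (s : 'S_n) of
    sval B = col_perm s (sval A) :
    St_rel (fgen A - fgen B *~ (-1) ^+ s).

Definition St (F : fieldType) (n : nat) : zmodType := zquot (@St_rel F n).

Definition st (F : fieldType) (n : nat) (A : GL F n) : St F n :=
  cls (@St_rel F n) (fgen A).

Section StRelations.
Variables (F : fieldType) (n : nat).
Implicit Types A B C : GL F n.

Lemma st_sum A B C (i j : 'I_n) (l : F) : (i < j)%N -> l != 0 ->
  sval B = setcol (sval A) i (col i (sval A) + l *: col j (sval A)) ->
  sval C = setcol (sval A) j (col i (sval A) + l *: col j (sval A)) ->
  st A = st B + st C.
Proof.
move=> ij l0 eB eC; rewrite -[RHS](raddfD (cls (@St_rel F n))).
by apply: cls_rel; apply: St_sum ij l0 eB eC.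
Qed.

Lemma st_scale A B (i : 'I_n) (l : F) : l != 0 ->
  sval B = setcol (sval A) i (l *: col i (sval A)) -> st A = st B.
Proof. by move=> l0 eB; apply: cls_rel; apply: St_scale l0 eB. Qed.

Lemma st_perm A B (s : 'S_n) :
  sval B = col_perm s (sval A) -> st A = st B *~ (-1) ^+ s.
Proof.
move=> eB; rewrite -[RHS](raddfMz (cls (@St_rel F n))).
by apply: cls_rel; apply: St_perm eB.
Qed.

End StRelations.

Section StAction.
Variables (F : fieldType) (n : nat).
Implicit Types (M N A : GL F n).

Definition St_act M : St F n -> St F n :=
  qlift (@St_rel F n) (flift (fun A => st (M * A)%g)).

Lemma col_mulmx (M A : 'M[F]_n) i : col i (M *m A) = M *m col i A.
Proof. by rewrite !colE mulmxA. Qed.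

Lemma mulmx_setcol (M A : 'M[F]_n) k v :
  M *m setcol A k v = setcol (M *m A) k (M *m v).
Proof.
apply/matrixP => r c; rewrite !mxE; case: eqP => ck.
  by apply: eq_bigr => s _; rewrite !mxE ck eqxx.
by apply: eq_bigr => s _; rewrite !mxE; case: eqP.
Qed.

Lemma St_act_rel M x : St_rel x -> flift (fun A => st (M * A)%g) x = 0.
Proof.
case=> [A B C i j l ij l0 eB eC|A B i l l0 eB|A B s eB].
- rewrite raddfB raddfD /= !flift_gen; apply/eqP; rewrite subr_eq0; apply/eqP.
  apply: (@st_sum _ _ _ _ _ i j l) => //=.
    by rewrite eB mulmx_setcol mulmxDr -scalemxAr !col_mulmx.
  by rewrite eC mulmx_setcol mulmxDr -scalemxAr !col_mulmx.
- rewrite raddfB /= !flift_gen; apply/eqP; rewrite subr_eq0; apply/eqP.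
  apply: (@st_scale _ _ _ _ i l) => //=.
  by rewrite eB mulmx_setcol -scalemxAr !col_mulmx.
- rewrite raddfB raddfMz /= !flift_gen; apply/eqP; rewrite subr_eq0; apply/eqP.
  by apply: st_perm => /=; rewrite eB !col_permE mulmxA.
Qed.

Lemma St_act_is_zmod_morphism M : zmod_morphism (St_act M).
Proof.
elim/zquot_ind=> x; elim/zquot_ind=> y.
by rewrite -raddfB /St_act !(qlift_cls (@St_act_rel M)) /= raddfB.
Qed.
HB.instance Definition _ M := GRing.isZmodMorphism.Build _ _ (St_act M)
  (St_act_is_zmod_morphism M).

Lemma St_actE M A : St_act M (st A) = st (M * A)%g.
Proof. by rewrite /St_act (qlift_cls (@St_act_rel M)) /= flift_gen. Qed.

Lemma St_ext (U : zmodType) (f g : {additive St F n -> U}) :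
  (forall A, f (st A) = g (st A)) -> f =1 g.
Proof.
move=> fg; elim/zquot_ind; apply: freeg_ind => [|x y fx fy|A].
- by rewrite !raddf0.
- by rewrite !raddfB fx fy.
- exact: fg.
Qed.

Lemma St_act1 : St_act 1%g =1 id.
Proof. by apply: (@St_ext _ (St_act 1%g) idfun) => A /=; rewrite St_actE mul1g. Qed.

Lemma St_actM M N : St_act (M * N)%g =1 St_act M \o St_act N.
Proof.
by apply: (@St_ext _ (St_act (M * N)%g) (St_act M \o St_act N)) => A /=;
  rewrite !St_actE mulgA.
Qed.

Definition St2 : zmodType := tensor (St F n) (St F n).

Definition St2_act M : St2 -> St2 := tensor_map (St_act M) (St_act M).
HB.instance Definition _ M := GRing.Additive.on (St2_act M).

Lemma St2_act1 : St2_act 1%g =1 id.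
Proof.
apply: (@tensor_ext _ _ _ (St2_act 1%g) idfun) => v w.
by rewrite /= /St2_act tensor_mapE /= !St_act1.
Qed.

Lemma St2_actM M N : St2_act (M * N)%g =1 St2_act M \o St2_act N.
Proof.
apply: (@tensor_ext _ _ _ (St2_act (M * N)%g) (St2_act M \o St2_act N)) => v w.
by rewrite /= /St2_act !tensor_mapE /= !St_actM.
Qed.

Inductive SL_coinv_rel : St2 -> Prop :=
| SL_coinv_diff M (x : St2) of \det (sval M) = 1 : SL_coinv_rel (St2_act M x - x).

Definition coinv : Type := zquot SL_coinv_rel.
HB.instance Definition _ := GRing.Zmodule.on coinv.

Definition coinv_GLact M : coinv -> coinv :=
  qlift SL_coinv_rel (cls SL_coinv_rel \o St2_act M).

Lemma coinv_GLact_rel M x : SL_coinv_rel x -> (cls SL_coinv_rel \o St2_act M) x = 0.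
Proof.
case=> N y dN; rewrite raddfB /=.
have -> : St2_act M (St2_act N y) = St2_act (M * N * M^-1)%g (St2_act M y).
  by rewrite -![St2_act _ (St2_act _ _)]St2_actM mulgVK.
apply/eqP; rewrite subr_eq0; apply/eqP; apply: cls_rel; constructor => /=.
have dM : \det (sval M) != 0 by rewrite -unitfE -unitmxE (svalP M).
by rewrite !det_mulmx det_inv dN mulr1 mulfV.
Qed.

Lemma coinv_GLact_is_zmod_morphism M : zmod_morphism (coinv_GLact M).
Proof.
elim/zquot_ind=> x; elim/zquot_ind=> y.
by rewrite -raddfB /coinv_GLact !(qlift_cls (@coinv_GLact_rel M)) raddfB.
Qed.

Lemma coinv_GLactE M x :
  coinv_GLact M (cls SL_coinv_rel x) = cls SL_coinv_rel (St2_act M x).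
Proof. by rewrite /coinv_GLact (qlift_cls (@coinv_GLact_rel M)). Qed.

Lemma coinv_GLact1 : coinv_GLact 1%g =1 id.
Proof. by elim/zquot_ind=> x; rewrite coinv_GLactE St2_act1. Qed.

Lemma coinv_GLactM M N : coinv_GLact (M * N)%g =1 coinv_GLact M \o coinv_GLact N.
Proof. by elim/zquot_ind=> x /=; rewrite !coinv_GLactE St2_actM. Qed.

Lemma coinv_SLact M : \det (sval M) = 1 -> coinv_GLact M =1 id.
Proof.
move=> dM; elim/zquot_ind=> x; rewrite coinv_GLactE.
by apply: cls_rel; constructor.
Qed.

Lemma coinv_GLact_det M N :
  \det (sval M) = \det (sval N) -> coinv_GLact M =1 coinv_GLact N.
Proof.
move=> dMN c; have -> : M = (N * (N^-1 * M))%g by rewrite mulgA mulgV mul1g.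
rewrite coinv_GLactM /= (@coinv_SLact (N^-1 * M)%g) //= det_mulmx det_inv dMN.
by rewrite mulVf // -unitfE -unitmxE (svalP N).
Qed.

(* diag(u, 1, ..., 1): a matrix of determinant u when n > 0. *)
Definition Fx_diag (u : Fx F) : 'M[F]_n :=
  diag_mx (\row_i if val i == 0 then sval u else 1).

Lemma Fx_diag_unit u : Fx_diag u \in unitmx.
Proof.
rewrite unitmxE det_diag unitfE; apply/prodf_neq0 => i _.
by rewrite mxE; case: ifP => _; rewrite ?oner_neq0 ?(svalP u).
Qed.

Definition Fx_GL (u : Fx F) : GL F n := mkGL (Fx_diag_unit u).

Lemma det_Fx_GL u : (0 < n)%N -> \det (sval (Fx_GL u)) = sval u.
Proof.
move=> n0; rewrite /= det_diag (bigD1 (Ordinal n0)) //= mxE /= big1 ?mulr1 //.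
by move=> i; rewrite mxE -val_eqE /= => /negPf ->.
Qed.

(* The residual action of u : F^*, that is of any M of determinant u; see
   coinv_FxactE. *)
Definition coinv_Fxact (u : Fx F) : coinv -> coinv := coinv_GLact (Fx_GL u).

Lemma coinv_FxactE M u : (0 < n)%N -> \det (sval M) = sval u ->
  coinv_Fxact u =1 coinv_GLact M.
Proof. by move=> n0 dM; apply: coinv_GLact_det; rewrite det_Fx_GL. Qed.

Lemma coinv_FxactB u : zmod_morphism (coinv_Fxact u).
Proof. exact: coinv_GLact_is_zmod_morphism. Qed.

Lemma coinv_Fxact1 : coinv_Fxact 1%g =1 id.
Proof.
apply: coinv_SLact; rewrite /= det_diag big1 // => i _.
by rewrite mxE; case: ifP.
Qed.

Lemma coinv_FxactM u v : coinv_Fxact (u * v)%g =1 coinv_Fxact u \o coinv_Fxact v.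
Proof.
move=> c; rewrite /coinv_Fxact /= -[RHS]coinv_GLactM.
congr (coinv_GLact _ c); apply: val_inj; rewrite /= /Fx_diag mulmx_diag.
by congr diag_mx; apply/rowP => i; rewrite !mxE; case: ifP; rewrite ?mulr1.
Qed.

HB.instance Definition _ :=
  GRing.Zmodule_isLmodule.Build (groupRing (Fx F)) coinv
    (act_scaleA coinv_FxactB coinv_FxactM) (act_scale1 coinv_Fxact1)
    (act_scaleDr coinv_FxactB) (@act_scaleDl _ _ coinv_Fxact).

End StAction.

(* Main.v *)
From HB Require Import structures.
Require Import Defs.
From mathcomp Require Import all_boot all_fingroup all_algebra.
From mathcomp Require Import generic_quotient zify ring.
From mathcomp Require Import freeg.

(** Write [A|B] for the class of [A] (x) [B] in the coinvariants.  A matrix M of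
determinant u sends [A|B] to [MA|MB], and this is the action of u, so up to F^*
every class has the form [1|B].  A scalar matrix l acts trivially on symbols by
relation (b) and has determinant l^n, hence n-th powers act trivially, and (i)
amounts to the coinvariants being generated by one class over Z[F^*].

Generation.  Relation (a) in the second symbol is a pair of column operations on
B.  In the first symbol, after translating back to the form [1|_], it becomes a
pair of row operations on B.  In both cases the class is expressed by two classes
in each of which one of two chosen entries has been cleared.  Clearing
alternately the part of a column above the diagonal block and the rest of a row
makes B bidiagonal with superdiagonal entries 0 or -1 (reduce_bidiag).  The
inverse of such a matrix is the 0-1 matrix X_e of an order e, a disjoint union of
chains; thus [1|B] is [X_e|1] up to F^*.  If a and b are incomparable elements of
a forest e, the columns of X_e at a and b are indicator functions of disjoint
sets, and relation (a) with l = 1 says that [X_e|1] is the sum of the classes of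
the two orders in which a is put below b, or b below a (dsymb_ordmx_attach).
Repeating this expresses [X_e|1] by total orders.  All total orders are conjugate
under permutation matrices, so they give one class up to the action of -1 and 1:
this class is the generator gen (span_forest, span_all).

Splitting.  Sending a symbol to the signed sum of its n! complete flags and
counting common flags defines an invariant form on St (x) St, that is, a
homomorphism coinv_form from the coinvariants to Z, with value 1 on gen.  Hence
the coinvariants are Z gen plus the kernel T.  Now let -1 be an n-th power, so
that it acts trivially.  The order made of a chain on n - 1 elements and one
isolated element has exactly n linear extensions, so its class is n gen.  The
matrices diag(u, 1, ..., 1) commute with the matrix of this order, so this class
is fixed by F^*.  Thus n (u gen) = n gen for all u, which gives
n c = coinv_form(c) n gen for every c, and n T = 0. *)

Set Implicit Arguments.
Unset Strict Implicit.
Unset Printing Implicit Defensive.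

Import GRing.Theory.
Local Open Scope ring_scope.

(** * Reduction of matrices to bidiagonal form *)

Section Elementary.
Variables (F : fieldType) (n : nat).
Implicit Types (A B : 'M[F]_n) (i j k : 'I_n) (l : F).

(** For i != j this is a transvection; the case i = j is kept because
[elmx i i (l - 1)] is the dilation by l, so one family of matrices covers
relations (a) and (b). *)
Definition elmx i j l : 'M[F]_n := 1%:M + l *: delta_mx i j.

Lemma mul_elmxE i j l A r c :
  (elmx i j l *m A) r c = A r c + (r == i)%:R * l * A j c.
Proof.
rewrite mulmxDl mul1mx -scalemxAl !mxE; congr (_ + _).
rewrite (bigD1 j) //= big1 => [|k kj]; rewrite !mxE ?eqxx ?andbT ?addr0.
  by rewrite mulrA [l * _]mulrC.
by rewrite (negPf kj) andbF mul0r.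
Qed.

Lemma mulmx_elmxE i j l A r c :
  (A *m elmx i j l) r c = A r c + (c == j)%:R * l * A r i.
Proof.
rewrite mulmxDr mulmx1 -scalemxAr !mxE; congr (_ + _).
rewrite (bigD1 i) //= big1 => [|k ki]; rewrite !mxE ?eqxx ?addr0.
  by rewrite [A r i * _]mulrC mulrCA mulrA.
by rewrite (negPf ki) mulr0.
Qed.

Lemma elmx_mulr i j l A :
  A *m elmx i j l = setcol A j (col j A + l *: col i A).
Proof.
apply/matrixP => r c; rewrite mulmx_elmxE !mxE.
by case: eqP => [->|]; rewrite ?mul1r // !mul0r addr0.
Qed.

Lemma det_elmx i j l : i != j -> \det (elmx i j l) = 1.
Proof.
move=> ij; rewrite -[elmx _ _ _]mul1mx elmx_mulr -[col j _]scale1r.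
by rewrite det_setcol ?det1 ?mulr1 // eq_sym.
Qed.

Lemma elmx_scaleE i l : elmx i i (l - 1) = diag_mx (\row_j if j == i then l else 1).
Proof.
apply/matrixP => r c; rewrite !mxE.
have [<-|rc] := eqVneq r c; last first.
  by case: eqP => [ri|]; rewrite ?andbF ?mulr0 ?addr0 // -ri eq_sym (negPf rc) mulr0 addr0.
by rewrite andbb; case: eqP; rewrite /= ?mulr1 ?mulr0 ?addr0 // addrC subrK.
Qed.

Lemma det_elmx_scale i l : \det (elmx i i (l - 1)) = l.
Proof.
rewrite elmx_scaleE det_diag (bigD1 i) //= mxE eqxx big1 ?mulr1 // => j ji.
by rewrite mxE (negPf ji).
Qed.

Lemma trmx_elmx i j l : (elmx i j l)^T = elmx j i l.
Proof. by rewrite /elmx linearD linearZ /= trmx1 trmx_delta. Qed.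

Lemma mul_elmx_inv i j l : i != j -> elmx i j l *m elmx i j (- l) = 1%:M.
Proof.
move=> ij; rewrite /elmx mulmxDl mul1mx -scalemxAl mulmxDr mulmx1.
rewrite -scalemxAr mul_delta_mx_0 1?eq_sym // scaler0 addr0 -addrA.
by rewrite scaleNr addNr addr0.
Qed.

End Elementary.

Section Reduction.
Variables (F : fieldType) (n : nat).
Implicit Types (A B : 'M[F]_n) (i j k : 'I_n) (l : F).

(** The closure properties, under row operations, of the set of matrices B whose
class [1|B] lies in a given F^*-stable subgroup.  The two premises of [rr_add]
are the two terms of relation (a). *)
Record row_rules (P : 'M[F]_n -> Prop) : Prop := RowRules {
  rr_add : forall i j l B, i != j -> l != 0 ->
    P (elmx i j l *m B) -> P (elmx j i l^-1 *m B) -> P B;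
  rr_scale : forall i l B, l != 0 -> P (elmx i i (l - 1) *m B) -> P B;
  rr_swap : forall i j B, P (xrow i j B) -> P B }.

(** When two rows i, j in J have nonzero entries in column c, both terms of
[rr_add], for a suitable l, lose one of these two entries, so the number of
nonzero entries of that column in J decreases. *)
Lemma row_clear (P C : 'M[F]_n -> Prop) (J : pred 'I_n) (c : 'I_n) :
  row_rules P ->
  (forall i j l B, J i -> J j -> C B -> C (elmx i j l *m B)) ->
  (forall B, C B -> (forall i j, J i -> J j -> B i c != 0 -> B j c != 0 -> i = j) ->
     P B) ->
  forall B, C B -> P B.
Proof.
move=> PR CJ base B.
move: {2}#|[pred i | J i & B i c != 0]|.+1 (ltnSn #|[pred i | J i & B i c != 0]|) => k.
elim: k B => // k IH B lek CB.
have [[i [j [Ji Jj Bi Bj ij]]]|none] :=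
  boolp.pselect (exists i j, [/\ J i, J j, B i c != 0, B j c != 0 & i != j]); last first.
  apply: base => // i j Ji Jj Bi Bj; apply/eqP; apply: boolp.contrapT => /negP ij.
  by apply: none; exists i, j.
have dec a b l : J a -> J b -> B a c != 0 -> B b c != 0 -> a != b ->
    B a c + l * B b c = 0 -> P (elmx a b l *m B).
  move=> Ja Jb Ba Bb ab e; apply: IH; last exact: CJ.
  rewrite ltnS in lek; apply: leq_trans lek; apply: proper_card.
  apply/properP; split; last first.
    by exists a; rewrite !inE ?Ja ?Ba //= mul_elmxE eqxx mul1r e eqxx.
  apply/subsetP => r; rewrite !inE mul_elmxE; case: (r =P a) => [->|_].
    by rewrite mul1r e eqxx andbF.
  by rewrite !mul0r addr0.
have l0 : - (B i c / B j c) != 0 by rewrite oppr_eq0 mulf_neq0 ?invr_eq0.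
apply: (rr_add PR ij l0); apply: dec => //; first by field.
  by rewrite eq_sym.
by field; rewrite oppr_eq0 Bj Bi.
Qed.

(** The flag [eps j] tells whether j is linked to j - 1; the sign is chosen so
that the inverse has entries 0 and 1. *)
Definition bidiag (eps : nat -> bool) : 'M[F]_n :=
  \matrix_(i, j) ((i == j)%:R - ((i.+1 == j :> nat) && eps j)%:R).

Definition bidiag_from a b eps B :=
  forall i j, (a <= i)%N || (b <= j)%N -> B i j = bidiag eps i j.

(** A permutation cannot send the rows from m on into the columns after m, so
every term of the Leibniz formula has a zero factor. *)
Lemma det0_corner m B :
  (forall i j, (m <= i)%N -> (j <= m)%N -> B i j = 0) -> (m < n)%N -> \det B = 0.
Proof.
move=> B0 mn; apply: big1 => s _.
have [i mi sm] : exists2 i : 'I_n, (m <= i)%N & (s i <= m)%N.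
  apply: boolp.contrapT => no.
  pose m' := Ordinal mn.
  have sub : s @: [set i : 'I_n | (m <= i)%N] \subset [set j : 'I_n | (m < j)%N].
    apply/subsetP => j /imsetP [i]; rewrite !inE => mi ->.
    by rewrite ltnNge; apply/negP => sm; apply: no; exists i.
  have := subset_leq_card sub; rewrite card_imset; last exact: perm_inj.
  apply/negP; rewrite -ltnNge; apply: proper_card; apply/properP; split.
    by apply/subsetP => i; rewrite !inE; apply: ltnW.
  by exists m'; rewrite !inE /= ?ltnn.
by rewrite (bigD1 i) //= B0 // mul0r mulr0.
Qed.

(** Induction on the size m + 1 of the corner that is still arbitrary.  Column
m + 1 has only its part above the corner to be normalised: row operations leave
at most one nonzero entry, moved to row m and scaled to -1; whether such an entry
exists decides [eps (m + 1)].  Then column operations leave one nonzero entry in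
row m of the corner, moved to the diagonal and scaled to 1; if there is none, the
matrix is singular.  The corner that remains has size m. *)
Lemma reduce_bidiag (P : 'M[F]_n -> Prop) :
  row_rules P -> row_rules (fun B => P B^T) ->
  (forall B, \det B = 0 -> P B) ->
  (forall eps, P (bidiag eps)) -> forall B, P B.
Proof.
move=> rowP colP singP bidP B.
suff main m : (m <= n)%N -> forall eps B, bidiag_from m m.+1 eps B -> P B.
  apply: (main n (leqnn n) xpredT) => i j.
  by rewrite leqNgt ltn_ord leqNgt ltnS ltnW ?ltn_ord.
elim: m => [|m IH] mn eps {}B.
  by move=> BE; suff -> : B = bidiag eps by []; apply/matrixP => i j; apply: BE.
pose om := Ordinal mn.
(* Proved first because all cases for column m + 1 end with it. *)
have clear_row eps' B' : bidiag_from m.+1 m.+1 eps' B' -> P B'.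
  move=> BE.
  pose C (A : 'M[F]_n) := bidiag_from m.+1 m.+1 eps' A^T.
  suff H A : C A -> P A^T by rewrite -[B']trmxK; apply: H; rewrite /C trmxK.
  (* Columns 0..m vanish below row m, so combining them changes nothing there. *)
  have low (r c : 'I_n) : (m < r)%N -> (c <= m)%N -> bidiag eps' r c = 0.
    move=> mr cm; rewrite mxE; case: eqP => [rc|_]; first by move: mr; rewrite rc ltnNge cm.
    by case: eqP => [rc|_]; rewrite ?subr0 //; lia.
  move: A; apply: (@row_clear _ C (fun j => j <= m)%N om colP).
    move=> i j l A im jm CA r c rc.
    have cA := CA _ _ rc; rewrite mxE in cA; rewrite mxE mul_elmxE cA.
    case: (c =P i) => [ci|_]; last by rewrite !mul0r addr0.
    have mr : (m < r)%N by move: rc; rewrite ci (leqNgt m.+1 i) ltnS im orbF.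
    have := CA r j; rewrite mr mxE => -> //.
    by rewrite [bidiag _ r j]low // mulr0 addr0.
  move=> A CA uniq.
  have [[j0 j0m Aj0]|none] := boolp.pselect (exists2 j : 'I_n, (j <= m)%N & A j om != 0); last first.
    apply: singP; apply: (@det0_corner m) => // i j mi jm.
    have := CA i j; rewrite mxE; case: (ltnP m i) => mi' /=.
      by move=> -> //; rewrite low.
    have -> : i = om by apply: val_inj; apply/eqP; rewrite eqn_leq mi' mi.
    by move=> _; apply/eqP; apply: boolp.contrapT => /negP h; apply: none; exists j.
  apply: (rr_swap colP (i := j0) (j := om)).
  apply: (rr_scale colP (i := om) (l := (A j0 om)^-1)); first by rewrite invr_eq0.
  apply: (IH (ltnW mn) eps') => r c; rewrite mxE mul_elmxE => rc.
  have row0 k : (k <= m)%N -> k != j0 -> A k om = 0.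
    by move=> km; apply: contra_neq_eq => Ak; apply: uniq.
  have [mc|cm] := ltnP m c.
    have co : c != om by rewrite -val_eqE /= gtn_eqF.
    have cj : c != j0 by rewrite -val_eqE /= gtn_eqF // (leq_ltn_trans j0m).
    rewrite (negPf co) !mul0r addr0 mxE tpermD 1?eq_sym //.
    by have := CA r c; rewrite mxE mc orbT => ->.
  have mr : (m <= r)%N by move: rc; rewrite [(m < c)%N]ltnNge cm orbF.
  have Alow (k k' : 'I_n) : (m < k')%N -> (k <= m)%N -> A k k' = 0.
    by move=> mk' km; have := CA k' k; rewrite mk' mxE => -> //; apply: low.
  have [rm|mr'] := eqVneq r om; last first.
    have {}mr : (m < r)%N by rewrite ltn_neqAle mr andbT eq_sym.
    have A0 (k : 'I_n) : (k <= m)%N -> A (tperm j0 om k) r = 0.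
      by move=> km; rewrite Alow //; case: tpermP.
    by rewrite [RHS]low // !mxE !A0 ?mulr0 ?addr0.
  rewrite {r rc mr}rm !mxE tpermR.
  have [->|co] := eqVneq c om.
    by rewrite tpermR gtn_eqF //= subr0 mulr1n; field.
  rewrite !mul0r addr0.
  have -> : (m.+1 == c) = false by apply/negP => /eqP mc; move: cm; rewrite -mc ltnn.
  rewrite subr0; case: tpermP => [cj|/eqP|cj _]; first last.
  - by rewrite row0 //; apply/eqP.
  - by rewrite (negPf co).
  by rewrite row0 // -cj eq_sym.
have [mn1|mn1] := ltnP m.+1 n; last first.
  move=> BE; apply: (clear_row eps) => i j ij; apply: BE.
  by move: ij; have := ltn_ord j; lia.
pose oc := Ordinal mn1.
move: B; pose C (B : 'M[F]_n) := bidiag_from m.+1 m.+2 eps B.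
apply: (@row_clear _ C (fun i => i <= m)%N oc rowP).
  move=> i j l A im jm CA r c rc.
  rewrite mul_elmxE (CA _ _ rc); case: (r =P i) => [ri|_]; last by rewrite !mul0r addr0.
  have mc : (m.+1 < c)%N by move: rc; rewrite ri (leqNgt m.+1 i) ltnS im.
  rewrite [A j c]CA ?mc ?orbT // [bidiag _ j c]mxE.
  have -> : (j == c) = false by apply/negP => /eqP jc; move: mc; rewrite -jc; lia.
  have -> : (j.+1 == c) = false by lia.
  by rewrite subrr mulr0 addr0.
move=> B CB uniq.
have [[i0 i0m Bi0]|none] := boolp.pselect (exists2 i : 'I_n, (i <= m)%N & B i oc != 0); last first.
  apply: (clear_row (fun k : nat => (k != m.+1) && eps k)) => i j ij; rewrite mxE.
  have [jm|jm] := eqVneq (j : nat) m.+1; last first.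
    by rewrite /= CB ?mxE //; move: ij; lia.
  rewrite /= andbF subr0; have -> : j = oc by apply: val_inj.
  have [mi|im] := ltnP m i.
    rewrite CB ?mi // mxE /=.
    have -> : (i.+1 == m.+1) = false by lia.
    by rewrite subr0.
  have -> : (i == oc) = false by rewrite -val_eqE /=; lia.
  by apply/eqP; apply: boolp.contrapT => /negP h; apply: none; exists i.
apply: (rr_swap rowP (i := i0) (j := om)).
apply: (rr_scale rowP (i := om) (l := - (B i0 oc)^-1)); first by rewrite oppr_eq0 invr_eq0.
apply: (clear_row (fun k : nat => (k == m.+1) || eps k)) => r c rc; rewrite mul_elmxE.
have col0 k : (k <= m)%N -> k != i0 -> B k oc = 0.
  by move=> km; apply: contra_neq_eq => Bk; apply: uniq.
have [mr|rm] := ltnP m r.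
  have ro : r != om by rewrite -val_eqE /= gtn_eqF.
  have ri : r != i0 by rewrite -val_eqE /= gtn_eqF // (leq_ltn_trans i0m).
  rewrite (negPf ro) !mul0r addr0 mxE tpermD 1?eq_sym //.
  rewrite CB ?mr // !mxE; congr (_ - _%:R); congr nat_of_bool.
  by case: eqP => //= rc'; case: eqP => //; lia.
have mc : (m < c)%N by move: rc; lia.
have [cm|mc'] := eqVneq c oc; last first.
  have {}mc : (m.+1 < c)%N by rewrite ltn_neqAle mc andbT eq_sym.
  have B0 (k : 'I_n) : (k <= m)%N -> B k c = 0.
    move=> km; rewrite CB ?mc ?orbT // mxE -val_eqE /=.
    have -> : (k == c :> nat) = false by lia.
    by rewrite (_ : (k.+1 == c) = false) ?subr0 //; lia.
  have -> : bidiag (fun k : nat => (k == m.+1) || eps k) r c = 0.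
    rewrite mxE -val_eqE /=.
    have -> : (r == c :> nat) = false by lia.
    have -> : (r.+1 == c) = false by lia.
    by rewrite subr0.
  have B1 (k : 'I_n) : (k <= m)%N -> B (tperm i0 om k) c = 0.
    by move=> km; rewrite B0 //; case: tpermP.
  by rewrite !mxE !B1 ?mulr0 ?addr0.
rewrite {c rc mc}cm !mxE tpermR eqxx /= andbT.
have -> : (r == oc) = false by rewrite -val_eqE /=; lia.
have [->|ro] := eqVneq r om.
  by rewrite tpermR eqxx /= !mulr1n mulr0n; field.
rewrite !mul0r addr0.
have -> : (r.+1 == m.+1) = false by rewrite eqSS; apply: negPf; rewrite -val_eqE in ro.
rewrite subr0; case: tpermP => [ri|/eqP|ri _]; first last.
- by rewrite col0 //; apply/eqP.
- by rewrite (negPf ro).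
by rewrite col0 // -ri eq_sym.
Qed.

End Reduction.

(** * Symbols and their classes in the coinvariants *)

Section Symbols.
Variables (F : fieldType) (n : nat).
Implicit Types (A B M : 'M[F]_n) (i j k : 'I_n) (l : F).

(** Extending the symbol by 0 to singular matrices makes the relations hold
without side conditions, since column operations preserve invertibility. *)
Definition symb A : St F n := if insub A is Some g then st g else 0.

Lemma symbE (g : GL F n) : symb (sval g) = st g.
Proof. by rewrite /symb valK. Qed.

Lemma symb_unitE A (uA : A \in unitmx) : symb A = st (mkGL uA).
Proof. by rewrite -symbE. Qed.

Lemma symb_sing A : A \notin unitmx -> symb A = 0.
Proof. by move=> uA; rewrite /symb insubN. Qed.

Lemma symb_mulr_unit A (T : 'M[F]_n) (f : St F n -> St F n) :
  T \in unitmx -> f 0 = 0 ->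
  (forall (uA : A \in unitmx) (uAT : A *m T \in unitmx), st (mkGL uA) = f (st (mkGL uAT))) ->
  symb A = f (symb (A *m T)).
Proof.
move=> uT f0 H; have [uA|nuA] := boolP (A \in unitmx).
  have uAT : A *m T \in unitmx by rewrite unitmx_mul uA.
  by rewrite !symb_unitE H.
by rewrite !symb_sing ?f0 // unitmx_mul negb_and nuA.
Qed.

Lemma symb_scale A i l : l != 0 -> symb (A *m elmx i i (l - 1)) = symb A.
Proof.
move=> l0; symmetry; apply: (@symb_mulr_unit _ _ id) => // [|uA uAT].
  by rewrite unitmxE det_elmx_scale unitfE.
apply: (st_scale l0 (i := i)) => /=; rewrite elmx_mulr; congr setcol.
by rewrite scalerBl scale1r addrC subrK.
Qed.

Lemma symb_perm A (s : 'S_n) : symb A = symb (col_perm s A) *~ (-1) ^+ s.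
Proof.
rewrite col_permE; apply: (@symb_mulr_unit _ _ (fun x => x *~ (-1) ^+ s)).
- exact: unitmx_perm.
- exact: mul0rz.
by move=> uA uAT; apply: st_perm; rewrite /= col_permE.
Qed.

Lemma unit_elmx i j l : i != j -> elmx i j l \in unitmx.
Proof. by move=> ij; rewrite unitmxE det_elmx // unitr1. Qed.

(** Relation (a) made symmetric in i and j: the column v_i + l v_j may be
divided by l, and both new symbols then come from transvections. *)
Lemma symb_add A i j l : i != j -> l != 0 ->
  symb A = symb (A *m elmx j i l) + symb (A *m elmx i j l^-1).
Proof.
wlog ij : i j l / (i < j)%N => [H|] nij l0.
  have [ij|ji|/val_inj ij] := ltngtP i j; first exact: H.
    by rewrite (H j i l^-1) ?invrK ?invr_eq0 // 1?eq_sym // addrC.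
  by rewrite ij eqxx in nij.
have [uA|nuA] := boolP (A \in unitmx); last first.
  by rewrite !symb_sing ?addr0 // unitmx_mul negb_and nuA.
have uB : A *m elmx j i l \in unitmx by rewrite unitmx_mul uA unit_elmx // eq_sym.
have uC : A *m elmx i j l^-1 *m elmx j j (l - 1) \in unitmx.
  by rewrite !unitmx_mul uA unit_elmx // unitmxE det_elmx_scale unitfE.
rewrite -[symb (_ *m elmx i j _)](symb_scale _ j l0) !symb_unitE.
apply: (st_sum ij l0) => /=; first by rewrite elmx_mulr.
apply/matrixP => r c; rewrite !mulmx_elmxE !mxE.
by case: eqP => [->|_]; rewrite ?mul0r ?addr0 // eqxx !mul1r; field.
Qed.

Lemma St_act_symb (M : GL F n) A : St_act M (symb A) = symb (sval M *m A).
Proof.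
have [uA|nuA] := boolP (A \in unitmx).
  have uMA : sval M *m A \in unitmx by rewrite unitmx_mul uA (svalP M).
  by rewrite !symb_unitE St_actE; congr st; apply: val_inj.
by rewrite !symb_sing ?raddf0 // unitmx_mul negb_and nuA orbT.
Qed.

Definition dsymb A B : coinv F n :=
  cls (@SL_coinv_rel F n) (tens (symb A) (symb B)).

Lemma tens0l (V W : zmodType) (w : W) : tens (0 : V) w = 0.
Proof. by apply: (addrI (tens 0 w)); rewrite -tensDl !addr0. Qed.
Lemma tens0r (V W : zmodType) (v : V) : tens v (0 : W) = 0.
Proof. by apply: (addrI (tens v 0)); rewrite -tensDr !addr0. Qed.
Lemma tensNl (V W : zmodType) (v : V) (w : W) : tens (- v) w = - tens v w.
Proof. by apply/eqP; rewrite -subr_eq0 opprK -tensDl addNr tens0l. Qed.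
Lemma tensNr (V W : zmodType) (v : V) (w : W) : tens v (- w) = - tens v w.
Proof. by apply/eqP; rewrite -subr_eq0 opprK -tensDr addNr tens0r. Qed.

Lemma dsymb_singl A B : A \notin unitmx -> dsymb A B = 0.
Proof. by move=> nA; rewrite /dsymb symb_sing // tens0l raddf0. Qed.
Lemma dsymb_singr A B : B \notin unitmx -> dsymb A B = 0.
Proof. by move=> nA; rewrite /dsymb (symb_sing nA) tens0r raddf0. Qed.

Lemma dsymb_addl A B i j l : i != j -> l != 0 ->
  dsymb A B = dsymb (A *m elmx j i l) B + dsymb (A *m elmx i j l^-1) B.
Proof. by move=> ij l0; rewrite /dsymb (symb_add A ij l0) tensDl raddfD. Qed.
Lemma dsymb_addr A B i j l : i != j -> l != 0 ->
  dsymb A B = dsymb A (B *m elmx j i l) + dsymb A (B *m elmx i j l^-1).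
Proof. by move=> ij l0; rewrite /dsymb (symb_add B ij l0) tensDr raddfD. Qed.

Lemma dsymb_scalel A B i l : l != 0 -> dsymb (A *m elmx i i (l - 1)) B = dsymb A B.
Proof. by move=> l0; rewrite /dsymb symb_scale. Qed.
Lemma dsymb_scaler A B i l : l != 0 -> dsymb A (B *m elmx i i (l - 1)) = dsymb A B.
Proof. by move=> l0; rewrite /dsymb symb_scale. Qed.

Lemma mulz_sign (V : zmodType) (v : V) (b : bool) :
  v *~ (-1) ^+ b = if b then - v else v.
Proof. by case: b; rewrite ?expr0 ?mulr1z // expr1 mulrN1z. Qed.

Lemma dsymb_permr A B (s : 'S_n) : dsymb A (col_perm s B) = if s : bool then - dsymb A B else dsymb A B.
Proof.
rewrite /dsymb (symb_perm B s) mulz_sign.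
by case: (odd_perm s); rewrite ?tensNr ?raddfN ?opprK.
Qed.
Lemma dsymb_perml A B (s : 'S_n) : dsymb (col_perm s A) B = if s : bool then - dsymb A B else dsymb A B.
Proof.
rewrite /dsymb (symb_perm A s) mulz_sign.
by case: (odd_perm s); rewrite ?tensNl ?raddfN ?opprK.
Qed.

Lemma dsymb_act (n_gt0 : (0 < n)%N) (u : Fx F) M A B :
  \det M = sval u -> coinv_Fxact u (dsymb A B) = dsymb (M *m A) (M *m B).
Proof.
move=> dM; have uM : M \in unitmx by rewrite unitmxE dM unitfE (svalP u).
rewrite (@coinv_FxactE _ _ (mkGL uM)) // coinv_GLactE /St2_act tensor_mapE /=.
by rewrite !St_act_symb.
Qed.

End Symbols.

(** * Orders, forests and the cyclic generator *)

Section Span.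
Variables (F : fieldType) (n : nat) (n_gt0 : (0 < n)%N).
Implicit Types (A B M : 'M[F]_n) (i j k : 'I_n) (l : F) (c : coinv F n) (e : rel 'I_n).

(** The column of k is the indicator function of the elements above k. *)
Definition ordmx e : 'M[F]_n := \matrix_(r, k) (e k r)%:R.

Definition gen : coinv F n := dsymb (ordmx (fun i j => i <= j)%N) 1%:M.

Definition span c : Prop := exists r : groupRing (Fx F), c = r *: gen.

Lemma scale_gen (u : Fx F) c : (fgen u : groupRing (Fx F)) *: c = coinv_Fxact u c.
Proof. exact: act_scale_gen. Qed.

Lemma span_gen : span gen. Proof. by exists 1; rewrite scale1r. Qed.
Lemma span0 : span 0. Proof. by exists 0; rewrite scale0r. Qed.
Lemma spanD c c' : span c -> span c' -> span (c + c').
Proof. by move=> [r ->] [s ->]; exists (r + s); rewrite scalerDl. Qed.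
Lemma spanN c : span c -> span (- c).
Proof. by move=> [r ->]; exists (- r); rewrite scaleNr. Qed.
Lemma span_act u c : span c -> span (coinv_Fxact u c).
Proof.
by move=> [r ->]; exists ((fgen u : groupRing _) * r); rewrite -scale_gen scalerA.
Qed.

(** Membership is insensitive to translation of both symbols by one matrix,
because the span is stable under F^*. *)
Lemma span_translate A B M M' : M *m M' = 1%:M ->
  span (dsymb (M' *m A) (M' *m B)) -> span (dsymb A B).
Proof.
move=> MM' h; have [uM _] := mulmx1_unit MM'.
have dM : \det M != 0 by rewrite -unitfE -unitmxE.
rewrite -[A]mul1mx -[B]mul1mx -MM' -!mulmxA -(@dsymb_act _ _ n_gt0 (mkFx dM)) //.
exact: span_act.
Qed.

(** A row operation on B in [1|B] is, by translation, relation (a), (b) or (c)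
applied to the first symbol. *)
Lemma span_dsymb1_row_rules : row_rules (fun B => span (dsymb 1%:M B)).
Proof.
split=> [i j l B ij l0 h1 h2|i l B l0 h|i j B h].
- rewrite (@dsymb_addl _ _ _ _ j i (- l)) ?oppr_eq0 // 1?eq_sym // !mul1mx.
  have ji : j != i by rewrite eq_sym.
  apply: spanD.
    apply: (span_translate (mul_elmx_inv (- l) ij)); rewrite opprK.
    by rewrite mul_elmx_inv.
  rewrite invrN; apply: (span_translate (mul_elmx_inv (- l^-1) ji)); rewrite opprK.
  by rewrite mul_elmx_inv.
- have li0 : l^-1 != 0 by rewrite invr_eq0.
  rewrite -(dsymb_scalel _ _ i li0) mul1mx.
  have e : elmx i i (l^-1 - 1) *m elmx i i (l - 1) = 1%:M.
    rewrite !elmx_scaleE mulmx_diag -diag_const_mx; congr diag_mx.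
    by apply/rowP => k; rewrite !mxE; case: eqP; rewrite ?mulr1 ?mulVf.
  by apply: (span_translate e); rewrite (mulmx1C e).
- have e : perm_mx (tperm i j) *m perm_mx (tperm i j) = 1%:M :> 'M[F]_n.
    by rewrite -perm_mxM tperm2 perm_mx1.
  have h2 : span (dsymb (perm_mx (tperm i j)) B).
    by apply: (span_translate e); rewrite e; move: h; rewrite xrowE.
  move: h2; have -> : perm_mx (tperm i j) = col_perm (tperm i j) 1%:M :> 'M[F]_n.
    by rewrite col_permE mul1mx tpermV.
  by rewrite dsymb_perml; case: odd_perm => // /spanN; rewrite opprK.
Qed.

Lemma span_dsymb_col_rules A : row_rules (fun B => span (dsymb A B^T)).
Proof.
split=> [i j l B ij l0 h1 h2|i l B l0|i j B].
- rewrite (@dsymb_addr _ _ _ _ i j l) //; apply: spanD.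
    by rewrite -trmx_elmx -trmx_mul.
  by rewrite -trmx_elmx -trmx_mul.
- by rewrite trmx_mul trmx_elmx dsymb_scaler.
- rewrite tr_xrow /xcol dsymb_permr.
  by case: odd_perm => // /spanN; rewrite opprK.
Qed.

(** In a forest the sets of elements above two incomparable elements are
disjoint, which is what makes sums of columns of the order matrix 0-1 again. *)
Record forest e : Prop := Forest {
  forest_refl : reflexive e;
  forest_anti : antisymmetric e;
  forest_trans : transitive e;
  forest_tree : forall x i j, e i x -> e j x -> e i j || e j i }.

(** The order obtained from e by putting a below b. *)
Definition attach e a b : rel 'I_n := fun i j => e i j || (i == a) && e b j.

Definition incomparable e i j := ~~ e i j && ~~ e j i.

Lemma ordmx_attach e a b : forest e -> incomparable e a b ->
  ordmx e *m elmx b a 1 = ordmx (attach e a b).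
Proof.
move=> fe /andP[ab ba]; apply/matrixP => r k; rewrite mulmx_elmxE !mxE mulr1 /attach.
case: (k =P a) => [->|_]; last by rewrite mul0r addr0 orbF.
rewrite mul1r; case ear: (e a r); case ebr: (e b r); rewrite ?addr0 ?add0r //.
by have := forest_tree fe ear ebr; rewrite (negPf ab) (negPf ba).
Qed.

Lemma dsymb_ordmx_attach e a b B : forest e -> incomparable e a b ->
  dsymb (ordmx e) B = dsymb (ordmx (attach e a b)) B + dsymb (ordmx (attach e b a)) B.
Proof.
move=> fe inc; have nab : a != b.
  by apply: contraTneq inc => ->; rewrite /incomparable (forest_refl fe).
rewrite (@dsymb_addl _ _ _ _ a b 1) ?oner_neq0 // invr1 !ordmx_attach //.
by rewrite /incomparable andbC.
Qed.

(** Putting a below b may destroy transitivity below a, and the tree condition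
above b, unless everything strictly below a or b is comparable with the other
one.  This holds for incomparable pairs that are as low as possible. *)
Lemma forest_attach e a b : forest e -> incomparable e a b ->
  (forall k, e k a -> k != a -> ~~ incomparable e k b) ->
  (forall k, e k b -> k != b -> ~~ incomparable e a k) ->
  forest (attach e a b).
Proof.
move=> fe /andP[ab ba] below_a below_b.
have tr := forest_trans fe; have rf := forest_refl fe.
split.
- by move=> x; rewrite /attach rf.
- move=> x y /andP[/orP[xy|/andP[/eqP -> bY]]] /orP[yx|/andP[/eqP ya bx]].
  + by apply: (forest_anti fe); rewrite xy.
  + by rewrite ya in xy; rewrite (tr _ _ _ bx xy) in ba.
  + by rewrite (tr _ _ _ bY yx) in ba.
  + by [].
- move=> y x z /orP[xy|/andP[/eqP -> bY]] /orP[yz|/andP[/eqP ya bz]].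
  + by rewrite /attach (tr _ _ _ xy yz).
  + rewrite /attach bz andbT; have [//|xa] := eqVneq x a; first by rewrite orbT.
    rewrite ya in xy; have := below_a _ xy xa; rewrite /incomparable negb_and !negbK.
    case/orP => [xb|bx]; first by rewrite (tr _ _ _ xb bz).
    by rewrite (tr _ _ _ bx xy) in ba.
  + by rewrite /attach eqxx (tr _ _ _ bY yz) orbT.
  + by rewrite ya (negPf ba) in bY.
have half x j : e b x -> e j x -> attach e a b a j || attach e a b j a.
  move=> bx jx; case/orP: (forest_tree fe bx jx) => [bj|jb].
    by rewrite /attach eqxx bj orbT.
  have [->|jb'] := eqVneq j b; first by rewrite /attach eqxx rf orbT.
  have := below_b _ jb jb'; rewrite /incomparable negb_and !negbK /attach.
  by case/orP => ->; rewrite ?orbT.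
move=> x i j /orP[ix|/andP[/eqP -> bx]] /orP[jx|/andP[/eqP -> bx']].
- by rewrite /attach; case/orP: (forest_tree fe ix jx) => ->; rewrite ?orbT.
- by rewrite orbC; apply: half ix.
- exact: half jx.
- by rewrite /attach rf.
Qed.

Lemma key_perm (f : 'I_n -> nat) : injective f ->
  exists s : 'S_n, forall i j, (s i <= s j)%N = (f i <= f j)%N.
Proof.
move=> f_inj; pose m i := #|[pred k | f k < f i]%N|.
have m_mono i j : (m i <= m j)%N = (f i <= f j)%N.
  apply/idP/idP => [|fij]; last first.
    by apply: subset_leq_card; apply/subsetP => k; rewrite !inE => /leq_trans; apply.
  apply: contraTT; rewrite -!ltnNge => fji; apply: proper_card; apply/properP; split.
    by apply/subsetP => k; rewrite !inE => /ltn_trans; apply.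
  by exists j; rewrite !inE ?ltnn.
have m_lt i : (m i < n)%N.
  rewrite -[ltnRHS]card_ord; apply: proper_card; apply/properP; split.
    by apply/subsetP.
  by exists i; rewrite !inE ?ltnn.
have s_inj : injective (fun i => Ordinal (m_lt i)).
  move=> i j [mij]; apply: f_inj; apply/eqP.
  by rewrite eqn_leq -!m_mono mij leqnn.
by exists (perm s_inj) => i j; rewrite !permE /= m_mono.
Qed.

Definition signFx (b : bool) : Fx F := mkFx (negbT (signr_eq0 F b)).

(** Relabelling by a permutation matrix P sends [X|1] to [P X P^-1|1]: the two
signs coming from relation (c) cancel, and det P = 1 or -1 is left. *)
Lemma dsymb_total e (f : 'I_n -> nat) : injective f -> (forall i j, e i j = (f i <= f j)%N) ->
  exists b, dsymb (ordmx e) 1%:M = coinv_Fxact (signFx b) gen.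
Proof.
move=> f_inj ef; have [s sf] := key_perm f_inj; exists s.
rewrite /gen (@dsymb_act _ _ n_gt0 _ (perm_mx s)) ?det_perm // mulmx1.
have -> : ordmx e = col_perm s (perm_mx s *m ordmx (fun i j => i <= j)%N).
  by rewrite -row_permE; apply/matrixP => r k; rewrite !mxE ef -sf.
have -> : perm_mx s = col_perm s^-1 1%:M :> 'M[F]_n by rewrite col_permE mul1mx invgK.
by rewrite [in RHS]dsymb_permr dsymb_perml odd_permV.
Qed.

(** Induction on the number of unrelated pairs.  The incomparable pair (a, b) is
chosen with the largest sum of the sizes of the sets above a and above b, as
forest_attach requires: an element strictly below a and incomparable with b
would give a larger sum. *)
Lemma span_forest e : forest e -> span (dsymb (ordmx e) 1%:M).
Proof.
pose m e := #|[pred p : 'I_n * 'I_n | ~~ e p.1 p.2]|.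
move: {2}(m e).+1 (ltnSn (m e)) => k; elim: k e => // k IH e mk fe.
have rf := forest_refl fe.
pose incp p := incomparable e p.1 p.2.
case: (pickP incp) => [p0 inc0|total]; last first.
  (* With no incomparable pair, counting the elements below ranks the order. *)
  pose f i := #|[pred j | e j i]|.
  have ef i j : e i j = (f i <= f j)%N.
    apply/idP/idP => [ij|].
      apply: subset_leq_card; apply/subsetP => k'; rewrite !inE => ki.
      exact: forest_trans fe _ _ _ ki ij.
    apply: contraTT => nij; rewrite -ltnNge.
    have ji : e j i by have := total (i, j); rewrite /incp /incomparable nij /= => /negbFE.
    apply: proper_card; apply/properP; split.
      by apply/subsetP => k'; rewrite !inE => kj; apply: forest_trans fe _ _ _ kj ji.
    by exists i; rewrite !inE.
  have f_inj : injective f.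
    by move=> i j fij; apply: (forest_anti fe); rewrite !ef fij leqnn.
  have [b ->] := dsymb_total f_inj ef; apply: span_act; exact: span_gen.
pose w (p : 'I_n * 'I_n) := (#|[pred j | e p.1 j]| + #|[pred j | e p.2 j]|)%N.
case: (arg_maxnP w inc0) => [[a b]] inc wmax {p0 inc0}.
have grow i j : e i j -> i != j -> (#|[pred k | e j k]| < #|[pred k | e i k]|)%N.
  move=> ij nij; apply: proper_card; apply/properP; split.
    by apply/subsetP => k'; rewrite !inE; apply: forest_trans fe _ _ _ ij.
  exists i; rewrite !inE //; apply: contraNN nij => ji.
  by apply/eqP; apply: (forest_anti fe); rewrite ij.
have below_a k' : e k' a -> k' != a -> ~~ incomparable e k' b.
  move=> ka nka; apply/negP => /(wmax (k', b)); rewrite /w /= leqNgt ltn_add2r.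
  by rewrite grow.
have below_b k' : e k' b -> k' != b -> ~~ incomparable e a k'.
  move=> kb nkb; apply/negP => /(wmax (a, k')); rewrite /w /= leqNgt ltn_add2l.
  by rewrite grow.
have incC : incomparable e b a by move: inc; rewrite /incp /incomparable andbC.
have smaller i j : incomparable e i j -> (m (attach e i j) < m e)%N.
  move=> /andP[ij ji]; apply: proper_card; apply/properP; split.
    by apply/subsetP => p; rewrite !inE negb_or => /andP[].
  by exists (i, j); rewrite !inE //= /attach eqxx rf orbT.
rewrite (dsymb_ordmx_attach _ fe inc); apply: spanD; apply: IH.
- by rewrite ltnS in mk; apply: leq_trans mk; apply: smaller.
- exact: forest_attach.
- by rewrite ltnS in mk; apply: leq_trans mk; apply: smaller.
- apply: forest_attach => // k' h h'; rewrite /incomparable andbC; [exact: below_b | exact: below_a].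
Qed.

(** The order whose matrix is the inverse of [bidiag eps]: i lies below j when
j <= i and all of j + 1, ..., i are linked to their predecessors. *)
Definition linked (eps : nat -> bool) : rel 'I_n :=
  fun i j => (j <= i)%N && [forall k : 'I_n, (j < k <= i)%N ==> eps k].

Lemma linked_forest eps : forest (linked eps).
Proof.
split=> [i|i j|j i k|x i j].
- by rewrite /linked leqnn; apply/forallP => k; apply/implyP => /andP[ik ki]; lia.
- by move=> /andP[/andP[ji _] /andP[ij _]]; apply: val_inj; apply/eqP; rewrite eqn_leq ij.
- move=> /andP[ji /forallP eij] /andP[kj /forallP ejk].
  rewrite /linked (leq_trans kj ji); apply/forallP => q; apply/implyP => /andP[kq qi].
  have [qj|jq] := leqP q j; first by have := ejk q; rewrite kq qj.
  by have := eij q; rewrite jq qi.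
wlog ij : i j / (i <= j)%N => [H|/andP[xi ei] /andP[xj /forallP ej]].
  by case/orP: (leq_total i j) => ij xi xj; [apply: H | rewrite orbC; apply: H].
apply/orP; right; rewrite /linked ij; apply/forallP => q; apply/implyP => /andP[iq qj].
by have := ej q; rewrite qj (leq_ltn_trans xi iq).
Qed.

Lemma linked_bidiag eps : ordmx (linked eps) *m bidiag F n eps = 1%:M.
Proof.
apply/matrixP => r j; rewrite !mxE.
under eq_bigr do rewrite !mxE mulrBr.
rewrite sumrB (bigD1 j) //= eqxx mulr1 big1 => [|k kj]; last by rewrite (negPf kj) mulr0.
(* Only row j - 1 of the bidiagonal matrix has an entry of column j off the diagonal. *)
rewrite addr0; have [r_lt|r_gt|rj] := ltngtP r j.
- have j1n : (j.-1 < n)%N by apply: leq_ltn_trans (leq_pred _) (ltn_ord j).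
  rewrite (bigD1 (Ordinal j1n)) //= big1 => [|k kj]; last first.
    case: eqP => [kj'|]; rewrite ?mulr0 //; case/eqP: kj.
    by apply: val_inj; rewrite /= -kj'.
  rewrite prednK ?(leq_ltn_trans _ r_lt) // eqxx addr0 -natrM mulnb.
  have -> : (r == j) = false by apply/negP => /eqP rj; rewrite rj ltnn in r_lt.
  apply/eqP; rewrite subr_eq0; apply/eqP; congr (_%:R); congr nat_of_bool.
  have rj1 : (r <= j.-1)%N by lia.
  rewrite /linked /= (ltnW r_lt) rj1 /=.
  apply/forallP/andP => [h|[/forallP h ej] k].
    split; last by have := h j; rewrite r_lt leqnn.
    apply/forallP => k; apply/implyP => /andP[rk kj]; have := h k.
    by rewrite rk (leq_trans kj) // leq_pred.
  apply/implyP => /andP[rk kj]; have [kj'|jk] := ltnP k j.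
    by have := h k; rewrite rk; have -> : (k <= j.-1)%N by lia.
  by have -> : k = j by apply: val_inj; apply/eqP; rewrite eqn_leq kj jk.
- have -> : (r == j) = false by apply/negP => /eqP rj; rewrite rj ltnn in r_gt.
  have -> : linked eps j r = false by rewrite /linked leqNgt r_gt.
  rewrite big1 ?subr0 // => k _; case: eqP => [kj|]; rewrite ?mulr0 //.
  by rewrite /linked (_ : (r <= k)%N = false) ?mul0r //; lia.
have -> : r = j by apply: val_inj.
rewrite (forest_refl (linked_forest eps)) eqxx big1 ?subr0 // => k _.
case: eqP => [kj|]; rewrite ?mulr0 //.
by rewrite /linked (_ : (j <= k)%N = false) ?mul0r //; lia.
Qed.

Lemma span_dsymb A B : span (dsymb A B).
Proof.
have [uA|nuA] := boolP (A \in unitmx); last by rewrite dsymb_singl //; exact: span0.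
apply: (span_translate (mulmxV uA)); rewrite mulVmx //.
move: (invmx A *m B) => {uA}B.
apply: (reduce_bidiag span_dsymb1_row_rules (span_dsymb_col_rules _)) => [C dC|eps].
  by rewrite dsymb_singr ?unitmxE ?dC ?unitr0 //; exact: span0.
apply: (span_translate (mulmx1C (linked_bidiag eps))); rewrite mulmx1 linked_bidiag.
exact: span_forest (linked_forest eps).
Qed.

Lemma coinv_ind (P : coinv F n -> Prop) :
  P 0 -> (forall c c', P c -> P c' -> P (c - c')) -> (forall A B : GL F n, P (dsymb (sval A) (sval B))) ->
  forall c, P c.
Proof.
move=> P0 PB Pcl; elim/zquot_ind=> x; elim/zquot_ind: x => x.
elim/freeg_ind: x => [|x y Px Py|[v w]]; rewrite ?raddf0 // ?raddfB; first exact: PB.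
rewrite -[cls _ (fgen _)]/(tens v w).
elim/zquot_ind: v => v; elim/freeg_ind: v => [|v v' Pv Pv'|A].
- by rewrite raddf0 tens0l raddf0.
- by rewrite raddfB tensDl tensNl raddfB; apply: PB.
elim/zquot_ind: w => w; elim/freeg_ind: w => [|w w' Pw Pw'|B].
- by rewrite raddf0 tens0r raddf0.
- by rewrite raddfB tensDr tensNr raddfB; apply: PB.
by have := Pcl A B; rewrite /dsymb !symbE.
Qed.

Lemma span_all c : span c.
Proof.
elim/coinv_ind: c => [|c c' sc sc'|A B]; last exact: span_dsymb.
- exact: span0.
- by apply: spanD => //; apply: spanN.
Qed.

End Span.

(** * Counting common flags *)

Section Form.
Variables (F : fieldType) (n : nat).
Implicit Types (A B M : 'M[F]_n) (i j k : 'I_n) (l : F) (s t u : 'S_n).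

(** For M = A^-1 B this says that the flag of A ordered by s is the flag of B
ordered by t, where a flag consists of the spans of the last columns. *)
Definition ptrig M s t : bool := [forall i : 'I_n, forall j : 'I_n, (i < j)%N ==> (M (s i) (t j) == 0)].

Lemma ptrigP M s t :
  reflect (forall i j, (i < j)%N -> M (s i) (t j) = 0) (ptrig M s t).
Proof.
apply: (iffP forallP) => [h i j ij|h i].
  by have /forallP/(_ j)/implyP/(_ ij)/eqP := h i.
by apply/forallP => j; apply/implyP => ij; apply/eqP/h.
Qed.

(** A column may be changed by a multiple of one that comes later in the order
without changing the flag. *)
Lemma ptrig_colop M i j a b s t : a != 0 -> (t^-1%g i < t^-1%g j)%N ->
  ptrig (setcol M i (a *: col i M + b *: col j M)) s t = ptrig M s t.
Proof.
move=> a0 ij; have nji : j != i.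
  by apply: contraTneq ij => ->; rewrite ltnn.
apply/ptrigP/ptrigP => h p q pq; have := h p q pq; rewrite !mxE.
  case: eqP => // qi; have := h p (t^-1%g j).
  rewrite permKV !mxE (negPf nji) => -> ; last by rewrite -(permK t q) qi in pq; exact: ltn_trans ij.
  by rewrite mulr0 addr0 qi => /eqP; rewrite mulf_eq0 (negPf a0) => /eqP.
case: eqP => // qi Mi; rewrite -qi Mi mulr0 add0r -(permKV t j) h ?mulr0 //.
by rewrite -qi permK in ij; exact: ltn_trans ij.
Qed.

Lemma ptrig_scale M i l s t : l != 0 -> ptrig (setcol M i (l *: col i M)) s t = ptrig M s t.
Proof.
move=> l0; apply/ptrigP/ptrigP => h p q pq; have := h p q pq; rewrite !mxE.
  by case: eqP => // -> /eqP; rewrite mulf_eq0 (negPf l0) => /eqP.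
by case: eqP => // -> ->; rewrite mulr0.
Qed.

Lemma ptrig_col_perm M u s t : ptrig (col_perm u M) s t = ptrig M s (t * u)%g.
Proof.
apply/ptrigP/ptrigP => h p q pq; by have := h p q pq; rewrite ?mxE permM ?mxE.
Qed.

(** Row i of N N' = 1 gives N i i * N' i j = 0 for i < j once the earlier rows of
N' are known to be triangular. *)
Lemma trig_inverse (N N' : 'M[F]_n) : N *m N' = 1%:M ->
  (forall i j, (i < j)%N -> N i j = 0) -> forall i j, (i < j)%N -> N' i j = 0.
Proof.
move=> NN' trN i.
have Nd k : N k k != 0.
  have [uN _] := mulmx1_unit NN'; move: uN; rewrite unitmxE unitfE det_trig.
    by move/prodf_neq0; apply.
  by apply/is_trig_mxP => p q /trN.
move: {2}(i : nat).+1 (ltnSn i) => m; elim: m i => // m IH i im j ij.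
have /matrixP/(_ i j) := NN'; rewrite !mxE (bigD1 i) //= big1 => [|k ki].
  have -> : (i == j) = false by apply/negP => /eqP e; rewrite e ltnn in ij.
  by rewrite addr0 => /eqP; rewrite mulf_eq0 (negPf (Nd i)) => /eqP.
have [ik|ki'|e] := ltngtP i k; first by rewrite trN // mul0r.
  by rewrite (IH k (leq_trans ki' im) j (ltn_trans ki' ij)) mulr0.
by rewrite (val_inj e) eqxx in ki.
Qed.

Lemma ptrig_inverse M M' s t : M *m M' = 1%:M -> ptrig M t s -> ptrig M' s t.
Proof.
move=> MM' /ptrigP h; apply/ptrigP.
pose N : 'M[F]_n := \matrix_(i, j) M (t i) (s j).
pose N' : 'M[F]_n := \matrix_(i, j) M' (s i) (t j).
suff H : forall i j, (i < j)%N -> N' i j = 0 by move=> i j /H; rewrite mxE.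
apply: (@trig_inverse N) => [|i j ij]; last by rewrite mxE h.
apply/matrixP => i j; rewrite !mxE -(inj_eq (@perm_inj _ t)).
have /matrixP/(_ (t i) (t j)) := MM'; rewrite !mxE => <-.
rewrite [RHS](reindex_inj (@perm_inj _ s)); apply: eq_bigr => k _.
by rewrite !mxE.
Qed.

(** For M = A^-1 B, the signed number of complete flags common to A and B. *)
Definition flag_count M : int :=
  \sum_(s : 'S_n) \sum_(t : 'S_n) (-1) ^+ s * (-1) ^+ t * (ptrig M s t)%:R.

Lemma flag_count_inv M : M \in unitmx -> flag_count (invmx M) = flag_count M.
Proof.
move=> uM; rewrite /flag_count exchange_big; apply: eq_bigr => s _; apply: eq_bigr => t _.
rewrite [_ ^+ t * _]mulrC; congr (_ * _%:R); congr nat_of_bool.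
apply/idP/idP; first by apply: ptrig_inverse; rewrite mulVmx.
by apply: ptrig_inverse; rewrite mulmxV.
Qed.

Lemma flag_count_scale M i l : l != 0 ->
  flag_count (setcol M i (l *: col i M)) = flag_count M.
Proof.
by move=> l0; apply: eq_bigr => s _; apply: eq_bigr => t _; rewrite ptrig_scale.
Qed.

Lemma flag_count_perm M u : flag_count (col_perm u M) = (-1) ^+ u * flag_count M.
Proof.
rewrite /flag_count mulr_sumr; apply: eq_bigr => s _.
rewrite mulr_sumr [RHS](reindex_inj (mulIg u)); apply: eq_bigr => t _.
rewrite ptrig_col_perm odd_permM.
rewrite signr_addb mulrA; congr (_ * _); rewrite mulrCA; congr (_ * _).
by case: (odd_perm t); case: (odd_perm u); rewrite /= ?expr1 ?expr0 ?mulr1 ?mul1r // mulrNN mulr1.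
Qed.

(** The flag of an ordering t of the columns depends on the later of the columns
i, j and on their common span, but not on the earlier one.  So the orderings of M
with i before j match those of the first term, the others match those of the
second, and the remaining orderings of the two terms give the same flags with
opposite signs, as the transposition (i j) exchanges them. *)
Lemma flag_count_add M i j l : i != j -> l != 0 ->
  let w := col i M + l *: col j M in
  flag_count M = flag_count (setcol M i w) + flag_count (setcol M j w).
Proof.
move=> ij l0 w; rewrite /flag_count -big_split; apply: eq_bigr => s _ /=.
rewrite -big_split /=.
under [RHS]eq_bigr do rewrite -!mulrA -!mulrDr.
under [LHS]eq_bigr do rewrite -!mulrA.
rewrite -!mulr_sumr; congr (_ * _).
pose pos t := (t^-1%g i < t^-1%g j)%N.
have posJ t : pos (t * tperm i j)%g = ~~ pos t.
  rewrite /pos invMg tpermV !permM tpermL tpermR -leqNgt ltn_neqAle.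
  have -> // : (t^-1%g j != t^-1%g i :> nat) by rewrite val_eqE (inj_eq perm_inj) eq_sym.
have eB t : pos t -> ptrig (setcol M i w) s t = ptrig M s t.
  by move=> p; rewrite /w -[col i M]scale1r ptrig_colop // oner_neq0.
have eC t : ~~ pos t -> ptrig (setcol M j w) s t = ptrig M s t.
  move=> p; rewrite /w addrC -[col i M]scale1r ptrig_colop //.
  by rewrite -posJ in p; move: p; rewrite /pos invMg tpermV !permM tpermL tpermR.
have eBC t : pos t -> ptrig (setcol M i w) s (t * tperm i j)%g = ptrig (setcol M j w) s t.
  move=> p; rewrite -ptrig_col_perm -(@ptrig_colop _ i j (- l) 1 s t) ?oppr_eq0 //.
  rewrite (_ : setcol (col_perm _ _) _ _ = setcol M j w) //.
  apply/matrixP => r c; rewrite !mxE.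
  have [->|ci] := eqVneq c i.
    rewrite tpermL tpermR eqxx (eq_sym j) (negPf ij).
    by rewrite mulNr mul1r addrC addrK.
  have [->|cj] := eqVneq c j; first by rewrite tpermR eqxx.
  by rewrite tpermD ?(negPf ci) // eq_sym.
rewrite [LHS](bigID pos) [RHS](bigID pos) /=.
rewrite [X in _ + X](reindex_inj (mulIg (tperm i j))) /=.
rewrite [X in _ = _ + X](reindex_inj (mulIg (tperm i j))) /=.
have posJ' t : ~~ pos (t * tperm i j)%g = pos t by rewrite posJ negbK.
rewrite !(eq_bigl _ _ posJ') -!big_split /=; apply: eq_bigr => t p.
have np : ~~ pos (t * tperm i j)%g by rewrite posJ'.
rewrite eB // eBC // (eC _ np) odd_permM odd_tperm ij.
rewrite signr_addb expr1 mulrN1 !mulrDr !mulNr.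
set x := _ * _; set y := _ * (ptrig M s (t * _))%:R; set z := _ * (ptrig (setcol M j w) s t)%:R.
by rewrite addrA addrK.
Qed.

Lemma flag_count_rel (G : 'M[F]_n) x : St_rel x ->
  flift (fun A : GL F n => flag_count (G *m sval A)) x = 0.
Proof.
case=> [A B C i j l ij l0 eB eC|A B i l l0 eB|A B s eB].
- rewrite raddfB raddfD /= !flift_gen eB eC !mulmx_setcol mulmxDr -scalemxAr -!col_mulmx.
  have nij : i != j by rewrite -val_eqE ltn_eqF.
  by rewrite (flag_count_add _ nij l0) subrr.
- rewrite raddfB /= !flift_gen eB mulmx_setcol -scalemxAr -col_mulmx.
  by rewrite (flag_count_scale _ _ l0) subrr.
- rewrite raddfB raddfMz /= !flift_gen eB col_permE mulmxA -col_permE flag_count_perm.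
  rewrite -mulrzr intz mulrAC -expr2 sqrr_sign mul1r.
  by rewrite subrr.
Qed.

End Form.

(** * The invariant form on the coinvariants *)

Lemma eq_flift (K : choiceType) (V : zmodType) (f g : K -> V) :
  f =1 g -> flift f =1 flift g.
Proof. by move=> fg D; apply: eq_bigr => k _; rewrite fg. Qed.

Lemma flift_subr (K : choiceType) (V : zmodType) (f g : K -> V) D :
  flift (fun k => f k - g k) D = flift f D - flift g D.
Proof. by rewrite /flift -sumrB; apply: eq_bigr => k _; rewrite mulrzBl. Qed.

Lemma qlift_is_zmod_morphism (V W : zmodType) (S : V -> Prop) (f : {additive V -> W}) :
  (forall s, S s -> f s = 0) -> zmod_morphism (qlift S f).
Proof.
move=> fS; elim/zquot_ind=> x; elim/zquot_ind=> y.
by rewrite -raddfB !(qlift_cls fS) raddfB.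
Qed.

Section Form.
Variables (F : fieldType) (n : nat).
Implicit Types (A B M : GL F n) (x y : St F n).

Definition form_l A : St F n -> int :=
  qlift (@St_rel F n) (flift (fun B => flag_count (sval A^-1%g *m sval B))).

Lemma form_l_is_zmod_morphism A : zmod_morphism (form_l A).
Proof. by apply: qlift_is_zmod_morphism => s; apply: flag_count_rel. Qed.
HB.instance Definition _ A :=
  GRing.isZmodMorphism.Build _ _ (form_l A) (form_l_is_zmod_morphism A).

Lemma form_lE A B : form_l A (st B) = flag_count (sval (A^-1 * B)%g).
Proof.
by rewrite /form_l /st (qlift_cls (flag_count_rel (sval A^-1%g))) /= flift_gen.
Qed.

Definition form x y : int := qlift (@St_rel F n) (flift (fun A => form_l A y)) x.

(** Common flags of A and B are those of B and A, so the relations in the first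
variable follow from those in the second. *)
Lemma form_rel y s : St_rel s -> flift (fun A => form_l A y) s = 0.
Proof.
move=> rs; elim/zquot_ind: y; apply: freeg_ind => [|a b ea eb|B].
- rewrite raddf0 /flift big1 // => A _; by rewrite raddf0 mul0rz.
- rewrite -[RHS](subr0 0) -{1}ea -eb -flift_subr; apply: eq_flift => A.
  by rewrite !raddfB.
rewrite -[RHS](flag_count_rel (sval B^-1%g) rs); apply: eq_flift => A.
rewrite form_lE -flag_count_inv ?(svalP (A^-1 * B)%g) //.
by rewrite -[invmx _]/(sval (A^-1 * B)^-1%g) invMg invgK.
Qed.

Lemma formE A y : form (st A) y = form_l A y.
Proof. by rewrite /form /st (qlift_cls (form_rel y)) /= flift_gen. Qed.

Lemma form_subl y : zmod_morphism (form^~ y).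
Proof. exact: qlift_is_zmod_morphism (form_rel y). Qed.

Lemma form_subr x : zmod_morphism (form x).
Proof.
move=> y y'; elim/zquot_ind: x; apply: freeg_ind => [|a b ea eb|A].
- by rewrite raddf0 !(zmod_mor0 (form_subl _)) subrr.
- by rewrite raddfB !form_subl ea eb; ring.
by rewrite -[cls _ _]/(st A) !formE raddfB.
Qed.

Lemma form_act M x y : form (St_act M x) (St_act M y) = form x y.
Proof.
elim/zquot_ind: x; apply: freeg_ind => [|a b ea eb|A].
- by rewrite !raddf0 !(zmod_mor0 (form_subl _)).
- by rewrite !raddfB !form_subl ea eb.
elim/zquot_ind: y; apply: freeg_ind => [|a b ea eb|B].
- by rewrite !raddf0 !(zmod_mor0 (form_subr _)).
- by rewrite !raddfB !form_subr ea eb.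
rewrite -[cls _ (fgen A)]/(st A) -[cls _ (fgen B)]/(st B) !St_actE !formE !form_lE.
by rewrite invMg mulgA mulgKV.
Qed.

Definition form2 : St2 F n -> int :=
  qlift (@tensor_rel _ _) (flift (fun p => form p.1 p.2)).

Lemma form2_rel s : @tensor_rel (St F n) (St F n) s -> flift (fun p => form p.1 p.2) s = 0.
Proof.
case=> *; rewrite raddfB raddfD /= !flift_gen /=.
  by rewrite (zmod_morD (form_subl _)) subrr.
by rewrite (zmod_morD (form_subr _)) subrr.
Qed.

Lemma form2_is_zmod_morphism : zmod_morphism form2.
Proof. exact: qlift_is_zmod_morphism form2_rel. Qed.
HB.instance Definition _ := GRing.isZmodMorphism.Build _ _ form2 form2_is_zmod_morphism.

Lemma form2E x y : form2 (tens x y) = form x y.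
Proof. by rewrite /form2 /tens (qlift_cls form2_rel) /= flift_gen. Qed.

(** Invariance holds under all of GL_n, because A^-1 B does not change when A
and B are translated; this is why F^* does not change the form either. *)
Lemma form2_act M t : form2 (St2_act M t) = form2 t.
Proof.
apply: (@tensor_ext _ _ _ (form2 \o St2_act M) form2) => x y /=.
by rewrite /St2_act tensor_mapE !form2E form_act.
Qed.

Lemma form2_coinv_rel s : SL_coinv_rel s -> form2 s = 0.
Proof. by case=> M x _; rewrite raddfB /= form2_act subrr. Qed.

Definition coinv_form : coinv F n -> int := qlift (@SL_coinv_rel F n) form2.

Lemma coinv_form_is_zmod_morphism : zmod_morphism coinv_form.
Proof. exact: qlift_is_zmod_morphism form2_coinv_rel. Qed.
HB.instance Definition _ := GRing.isZmodMorphism.Build _ _ coinv_form coinv_form_is_zmod_morphism.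

Lemma coinv_form_dsymb A B : coinv_form (dsymb (sval A) (sval B)) = flag_count (sval (A^-1 * B)%g).
Proof. by rewrite /coinv_form /dsymb (qlift_cls form2_coinv_rel) /= form2E !symbE formE form_lE. Qed.

Lemma coinv_form_act u c : coinv_form (coinv_Fxact u c) = coinv_form c.
Proof.
elim/zquot_ind: c => x; rewrite /coinv_Fxact coinv_GLactE.
by rewrite /coinv_form !(qlift_cls form2_coinv_rel) /= form2_act.
Qed.

Lemma perm_le_id (s : 'S_n) : (forall i, s i <= i)%N -> s = 1%g.
Proof.
move=> le; apply/permP => i; rewrite perm1; move: {2}(i : nat).+1 (ltnSn i) => m.
elim: m i => // m IH i im; have := le i; rewrite leq_eqVlt => /orP[/eqP/val_inj //|lt].
by apply: (@perm_inj _ s); apply: IH; apply: leq_trans lt _; rewrite -ltnS.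
Qed.

(** The standard flag is the only one in common: if s i < t j whenever i < j,
then n - 1 - i values of t lie above s i, which forces s i <= i. *)
Lemma flag_count_ordmx : flag_count (ordmx F (fun i j : 'I_n => i <= j)%N) = 1.
Proof.
set X := ordmx _ _.
have tri1 s t : ptrig X s t -> (s == 1%g) && (t == 1%g).
  move=> /ptrigP h; have lt (i j : 'I_n) : (i < j)%N -> (s i < t j)%N.
    move=> /h /eqP; rewrite mxE ltnNge; case: leqP => // _; by rewrite oner_eq0.
  have s1 : s = 1%g.
    apply: perm_le_id => i; rewrite leqNgt; apply/negP => isi.
    have : (#|[set t j | j : 'I_n & i < j]| <= #|[set k : 'I_n | s i < k]|)%N.
      by apply: subset_leq_card; apply/subsetP => k /imsetP[j]; rewrite !inE => /lt ? ->.
    apply/negP; rewrite -ltnNge card_imset; last exact: perm_inj.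
    apply: proper_card; apply/properP; split.
      by apply/subsetP => k; rewrite !inE; apply: ltn_trans.
    by exists (s i); rewrite !inE ?ltnn.
  rewrite s1 eqxx /= -eq_invg1 (@perm_le_id t^-1%g) // => k; rewrite leqNgt; apply/negP => /lt.
  by rewrite s1 perm1 permKV ltnn.
rewrite /flag_count (bigD1 1%g) //= [X in _ + X]big1 => [|s s1]; last first.
  apply: big1 => t _; case: (boolP (ptrig X s t)) => [/tri1|_]; last by rewrite mulr0.
  by rewrite (negPf s1).
rewrite addr0 (bigD1 1%g) //= big1 => [|t t1]; last first.
  case: (boolP (ptrig X 1 t)) => [/tri1|_]; last by rewrite mulr0.
  by rewrite (negPf t1) andbF.
rewrite odd_perm1 /= addr0 (_ : ptrig X 1 1) //.
apply/ptrigP => i j ij; rewrite !perm1 mxE; by rewrite leqNgt ij.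
Qed.

Lemma coinv_form_gen : coinv_form (gen F n) = 1.
Proof.
have uX : ordmx F (fun i j : 'I_n => i <= j)%N \in unitmx.
  rewrite unitmxE det_trig; last first.
    by apply/is_trig_mxP => i j ij; rewrite mxE leqNgt ij.
  by rewrite big1 ?unitr1 // => i _; rewrite mxE leqnn.
rewrite /gen; have := coinv_form_dsymb (mkGL uX) 1%g; rewrite /= => ->.
by rewrite mulmx1 flag_count_inv // flag_count_ordmx.
Qed.

End Form.

(** * Powers act trivially; the torsion of the kernel *)

Section PowerAction.
Variables (F : fieldType) (n : nat) (n_gt0 : (0 < n)%N).
Implicit Types (A B : 'M[F]_n) (u v : Fx F) (c : coinv F n).

(** The scalar matrix is a product of dilations, one for each column. *)
Lemma symb_mul_scalar A (l : F) : l != 0 -> symb (A *m l%:M) = symb A.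
Proof.
move=> l0; pose D k : 'M[F]_n := diag_mx (\row_(j < n) if (j < k)%N then l else 1).
have -> : l%:M = D n.
  by rewrite -diag_const_mx /D; congr diag_mx; apply/rowP => j; rewrite !mxE ltn_ord.
suff H k : (k <= n)%N -> symb (A *m D k) = symb A by apply: H.
elim: k => [|k IH] kn.
  rewrite (_ : D 0 = 1%:M) ?mulmx1 // -diag_const_mx /D; congr diag_mx.
  by apply/rowP => j; rewrite !mxE.
rewrite -IH; last exact: ltnW.
have -> : D k.+1 = D k *m elmx (Ordinal kn) (Ordinal kn) (l - 1).
  rewrite elmx_scaleE mulmx_diag /D; congr diag_mx; apply/rowP => j; rewrite !mxE.
  rewrite -val_eqE /= ltnS leq_eqVlt; case: eqP => [->|_] /=; first by rewrite ltnn mul1r.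
  by rewrite mulr1.
by rewrite mulmxA symb_scale.
Qed.

Lemma sval_FxX u k : sval (u ^+ k)%g = sval u ^+ k.
Proof. by elim: k => [|k IH]; rewrite ?expg0 // expgS exprS -IH. Qed.

(** The scalar matrix v has determinant v^n and fixes every symbol. *)
Lemma coinv_Fxact_pow v c : coinv_Fxact (v ^+ n)%g c = c.
Proof.
elim/coinv_ind: c => [|c c' ec ec'|A B].
- by rewrite (zmod_mor0 (coinv_FxactB _)).
- by rewrite coinv_FxactB ec ec'.
rewrite (@dsymb_act _ _ n_gt0 _ (sval v)%:M) ?det_scalar ?sval_FxX //.
by rewrite /dsymb -!scalar_mxC !symb_mul_scalar ?(svalP v).
Qed.

End PowerAction.

Section Star.
Variables (F : fieldType) (n : nat) (n_gt0 : (0 < n)%N).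
Hypothesis sign_trivial :
  forall b, coinv_Fxact (signFx F b) (gen F n) = gen F n.

Let o0 : 'I_n := Ordinal n_gt0.

(** The chain 1 < 2 < ... < n - 1 with the element 0 put above those elements
that are smaller than k: for k = 1 the element 0 is isolated, for k = n the order
is total.  Since 0 and k are incomparable, attaching them leads either to a total
order or to [star k.+1], so that [star 1] has n linear extensions. *)
Definition star k : rel 'I_n :=
  fun i j => ((0 < i) && (i <= j))%N || ((j == 0 :> nat) && (i < k)%N).

Lemma star_forest k : (0 < k)%N -> forest (star k).
Proof.
move=> k0; split=> [i|i j|j i q|x i j]; rewrite /star; try lia.
by move=> h; apply: val_inj => /=; lia.
Qed.

Lemma dsymb_star d : (d < n)%N -> dsymb (ordmx F (star (n - d))) 1%:M = gen F n *+ d.+1.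
Proof.
have total e (f : 'I_n -> nat) : injective f ->
    (forall i j, e i j = (f i <= f j)%N) -> dsymb (ordmx F e) 1%:M = gen F n.
  by move=> f_inj ef; have [b ->] := dsymb_total F n_gt0 f_inj ef; apply: sign_trivial.
elim: d => [|d IH] dn.
  rewrite mulr1n; apply: (total _ (fun i : 'I_n => if i == 0 :> nat then n else i)).
    by move=> i j; have := ltn_ord i; have := ltn_ord j; do 2 case: eqP; move=> *; apply: val_inj => /=; lia.
  move=> i j; rewrite /star subn0; have := ltn_ord i; have := ltn_ord j.
  do 2 case: eqP; lia.
have kn : (n - d.+1 < n)%N by lia.
pose ok : 'I_n := Ordinal kn.
have k0 : (0 < n - d.+1)%N by lia.
have inc : incomparable (star (n - d.+1)) o0 ok by rewrite /incomparable /star /=; lia.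
rewrite (dsymb_ordmx_attach _ (star_forest k0) inc) mulrS; congr (_ + _).
  (* Putting 0 below k = n - d.+1 gives 1 < ... < k - 1 < 0 < k < ... < n - 1. *)
  apply: (total _ (fun i : 'I_n => if i == 0 :> nat then (n - d.+1).-1
    else if (i < n - d.+1)%N then i.-1 else i)).
    move=> i j; do 2 (case: eqP => ?; try case: ltnP => ?); move=> *; apply: val_inj => /=; lia.
  move=> i j; rewrite /attach /star -val_eqE /=.
  have [i0|i0] := eqVneq (i : nat) 0%N; have [j0|j0] := eqVneq (j : nat) 0%N;
    have [ik|ik] := ltnP i (n - d.+1); have [jk|jk] := ltnP j (n - d.+1); lia.
rewrite -IH; last lia.
congr (dsymb _ _); apply/matrixP => r k; rewrite !mxE; congr (_%:R); congr nat_of_bool.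
rewrite /attach /star -val_eqE /=; lia.
Qed.

(** 0 is isolated in [star 1], so dilations along 0 commute with the matrix of
the order, and they do not change symbols. *)
Lemma act_star u : coinv_Fxact u (dsymb (ordmx F (star 1)) 1%:M) = dsymb (ordmx F (star 1)) 1%:M.
Proof.
have u0 : sval u != 0 by exact: svalP u.
rewrite (@dsymb_act _ _ n_gt0 _ (elmx o0 o0 (sval u - 1))) ?det_elmx_scale //.
have -> : elmx o0 o0 (sval u - 1) *m ordmx F (star 1) = ordmx F (star 1) *m elmx o0 o0 (sval u - 1).
  apply/matrixP => r k; rewrite mul_elmxE mulmx_elmxE; congr (_ + _).
  have -> : (ordmx F (star 1)) o0 k = (k == o0)%:R.
    rewrite mxE; congr (_%:R); congr nat_of_bool; rewrite /star -val_eqE /=; lia.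
  have -> : (ordmx F (star 1)) r o0 = (r == o0)%:R.
    rewrite mxE; congr (_%:R); congr nat_of_bool; rewrite /star -val_eqE /=; lia.
  by rewrite mulrC mulrA mulrAC.
by rewrite dsymb_scalel // mulmx1 -[elmx _ _ _]mul1mx dsymb_scaler.
Qed.

Lemma act_gen_n u : coinv_Fxact u (gen F n) *+ n = gen F n *+ n.
Proof.
have e : gen F n *+ n = dsymb (ordmx F (star 1)) 1%:M.
  have d : (n.-1 < n)%N by lia.
  by have := dsymb_star d; rewrite (_ : n - n.-1 = 1)%N ?prednK //; lia.
rewrite -scale_gen scalerMnr scale_gen e; exact: act_star.
Qed.

(** Both sides are additive and agree on u gen, by act_gen_n. *)
Lemma mulrn_coinv_form c : c *+ n = (gen F n *+ n) *~ coinv_form c.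
Proof.
have [r ->] := span_all n_gt0 c; elim/groupRing_ind: r => [|r s er es|u].
- by rewrite scale0r raddf0 mulr0z mul0rn.
- by rewrite scalerBl mulrnBl er es raddfB mulrzBr.
by rewrite scale_gen act_gen_n coinv_form_act coinv_form_gen mulr1z.
Qed.

End Star.

Section Kernel.
Variables (F : fieldType) (n : nat).

Definition ker_coinv_form : {pred coinv F n} := fun c => coinv_form c == 0.

Lemma ker_coinv_formE c : (c \in ker_coinv_form) = (coinv_form c == 0).
Proof. by []. Qed.

Lemma ker_coinv_form_zmod_closed : zmod_closed ker_coinv_form.
Proof.
split=> [|x y]; rewrite !ker_coinv_formE ?raddf0 // raddfB => /eqP ex /eqP ey.
by rewrite /= ex ey subrr.
Qed.
HB.instance Definition _ := GRing.isZmodClosed.Build (coinv F n) ker_coinv_form ker_coinv_form_zmod_closed.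

Record coinv_ker := CoinvKer { coinv_ker_val : coinv F n; _ : coinv_ker_val \in ker_coinv_form }.
HB.instance Definition _ := [isSub for coinv_ker_val].
HB.instance Definition _ := [Choice of coinv_ker by <:].
HB.instance Definition _ := [SubChoice_isSubZmodule of coinv_ker by <:].

Definition coinv_form_split (p : (int * coinv_ker)%type) : coinv F n := gen F n *~ p.1 + val p.2.

Lemma coinv_form_split_is_zmod_morphism : zmod_morphism coinv_form_split.
Proof.
move=> p q; rewrite -[LHS]/(gen F n *~ (p.1 - q.1) + val (p.2 - q.2)).
by rewrite mulrzBr (GRing.valB p.2) -addrACA -opprD.
Qed.
HB.instance Definition _ := GRing.isZmodMorphism.Build _ _ coinv_form_split coinv_form_split_is_zmod_morphism.

Lemma coinv_form_splitE c : coinv_form (coinv_form_split c) = c.1.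
Proof.
case: c => k [t /= tk]; rewrite /coinv_form_split raddfD raddfMz /= coinv_form_gen.
by move: tk; rewrite ker_coinv_formE => /eqP ->; rewrite addr0 intz.
Qed.

Lemma coinv_form_split_bij : bijective coinv_form_split.
Proof.
have ker c : c - gen F n *~ coinv_form c \in ker_coinv_form.
  by rewrite ker_coinv_formE raddfB raddfMz /= coinv_form_gen intz subrr.
exists (fun c => (coinv_form c, CoinvKer (ker c))) => [p|c]; last first.
  by rewrite /coinv_form_split /= addrC subrK.
rewrite [RHS]surjective_pairing; apply: (f_equal2 pair); first exact: coinv_form_splitE.
by apply: val_inj; rewrite /= coinv_form_splitE /coinv_form_split addrC addKr.
Qed.

End Kernel.

Theorem theoremB (F : fieldType) (n : nat) (n_gt0 : (0 < n)%N) :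
  (exists phi : {linear ZFxModPow F n -> coinv F n},
     forall c : coinv F n, exists x : ZFxModPow F n, phi x = c) /\
  ((exists z : F, z ^+ n = -1) ->
   exists (T : zmodType) (psi : {additive (int * T)%type -> coinv F n}),
     bijective psi /\ (forall t : T, t *+ n = 0)).
Proof.
split.
  (* A class mod n-th powers acts through any representative. *)
  pose g (p : FxModPow F n) := coinv_Fxact (repr p) (gen F n).
  have gE u : g (pcls n u) = coinv_Fxact u (gen F n).
    have cu : pcls n u = pcls n (repr (pcls n u)) by rewrite [RHS]reprK.
    have [v uv] := (pcls_eqP _ _ _).1 cu.
    by rewrite [in RHS]uv coinv_FxactM /= coinv_Fxact_pow.
  pose phi : ZFxModPow F n -> coinv F n := flift g.
  have phiB : zmod_morphism phi by exact: flift_is_zmod_morphism.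
  have phiZ : scalable phi.
    move=> r x; elim/groupRing_ind: r => [|r s er es|u].
    - by rewrite !scale0r (zmod_mor0 phiB).
    - by rewrite !scalerBl phiB er es.
    elim/groupRing_ind: x => [|x y ex ey|p].
    - by rewrite scaler0 (zmod_mor0 phiB) scaler0.
    - by rewrite scalerBr !phiB ex ey scalerBr.
    elim/pcls_ind: p => v.
    have e : (fgen u : groupRing (Fx F)) *: (fgen (pcls n v) : ZFxModPow F n)
        = fgen (pcls n (u * v)%g).
      by apply: etrans (act_scale_gen _ _ _) _; rewrite /pow_act groupRing_mul_gen -pclsM.
    rewrite [X in phi X]e /phi !flift_gen !gE coinv_FxactM.
    exact/esym/scale_gen.
  pose phiL : {linear ZFxModPow F n -> coinv F n} :=
    HB.pack phi (GRing.isZmodMorphism.Build _ _ phi phiB) (GRing.isScalable.Build _ _ _ _ phi phiZ).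
  exists phiL => c; have [r ->] := span_all n_gt0 c.
  exists (r *: (fgen (pcls n 1%g) : ZFxModPow F n)).
  rewrite linearZ /=; congr (_ *: _).
  by rewrite /phi flift_gen gE coinv_Fxact1.
move=> [z zn].
have sign b : coinv_Fxact (signFx F b) (gen F n) = gen F n.
  case: b; last by rewrite -[RHS]coinv_Fxact1; congr (coinv_Fxact _ _); apply: val_inj.
  have z0 : z != 0.
    by apply: contra_eq_neq zn => ->; rewrite expr0n gtn_eqF // eq_sym oppr_eq0 oner_eq0.
  rewrite -[RHS](coinv_Fxact_pow n_gt0 (mkFx z0)); congr (coinv_Fxact _ _).
  by apply: val_inj; rewrite -[RHS]/(sval (mkFx z0 ^+ n)%g) sval_FxX /= zn expr1.
exists (coinv_ker F n), (@coinv_form_split F n); split; first exact: coinv_form_split_bij.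
move=> [t tk]; apply: val_inj; rewrite raddfMn raddf0 /= (mulrn_coinv_form n_gt0 sign).
by move: tk; rewrite ker_coinv_formE => /eqP ->.
Qed.
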